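(* Let $d\in\mathbb{N}$, let $V:\mathbb{Z}^d\to\mathbb{R}$, and let $H_V=-\Delta+V$ be the discrete Schrödinger operator on $\ell^2(\mathbb{Z}^d)$. Let $\sup\sigma(H_V)=\sup\sigma_{\mathrm{ess}}(H_V)=4d$ and let $H_V$ be critical at $4d$ from above. If there exist $s\in\mathbb{N}_0$ and $\varepsilon>0$ such that $$\begin{aligned}V_n\leq2d&-\sum_{j=1}^{d}\left(\frac{|n|}{|n+\delta_j|}\right)^{d/2}\left(\prod_{i=1}^{s}\sqrt{\frac{\log_i|n|}{\log_i|n+\delta_j|}}\right)\left(\frac{\log_s|n|}{\log_s|n+\delta_j|}\right)^{\varepsilon}\\&-\sum_{j=1}^{d}\left(\frac{|n|}{|n-\delta_j|}\right)^{d/2}\left(\prod_{i=1}^{s}\sqrt{\frac{\log_i|n|}{\log_i|n-\delta_j|}}\right)\left(\frac{\log_s|n|}{\log_s|n-\delta_j|}\right)^{\varepsilon}\end{aligned}$$ for all $n\in\mathbb{Z}^d$ with $|n|$ sufficiently large, then $4d\in\sigma_{\mathrm{p}}(H_V)$. In particular, if there exist $s\in\mathbb{N}_0$ and $\varepsilon>0$ such that $$V_n\leq-\frac{d(4-d)}{4|n|^2}-\frac{1}{|n|^2}\sum_{j=1}^{s}\prod_{k=1}^{j}\frac{1}{\log_k|n|}-\frac{\varepsilon}{|n|^2}\prod_{k=1}^{s}\frac{1}{\log_k|n|}$$ for all $n\in\mathbb{Z}^d$ with $|n|$ sufficiently large, then $4d\in\sigma_{\mathrm{p}}(H_V)$.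
   Context: The discrete Laplacian is $(-\Delta\psi)_n:=\sum_{m\in\mathbb{Z}^d,\,|m-n|=1}(\psi_n-\psi_m)$ for $\psi:\mathbb{Z}^d\to\mathbb{C}$, $n\in\mathbb{Z}^d$, where $|\cdot|$ is the Euclidean norm; it is a bounded self-adjoint operator on $\ell^2(\mathbb{Z}^d)$ with spectrum $[0,4d]$. A potential $V:\mathbb{Z}^d\to\mathbb{R}$ is identified with the multiplication operator $(V\psi)_n=V_n\psi_n$ on its maximal domain $\{\psi\in\ell^2(\mathbb{Z}^d): V\psi\in\ell^2(\mathbb{Z}^d)\}$, and $H_V:=-\Delta+V$ is self-adjoint on this domain. $\sigma(H)$, $\sigma_{\mathrm{p}}(H)$, $\sigma_{\mathrm{ess}}(H)$ denote the spectrum, the point spectrum (set of eigenvalues) and the essential spectrum. If $H_V$ is bounded from above and $s_+:=\sup\sigma(H_V)$, then $H_V$ is called critical at $s_+$ from above if for every compact multiplication operator $W\geq0$ (by a function $W:\mathbb{Z}^d\to\mathbb{R}$), $\sup\sigma(H_V+W)=s_+$ implies $W=0$. $\delta_j$ is the $j$-th standard basis vector of $\mathbb{Z}^d$. Iterated logarithms: $\log_0x:=x$ and $\log_{k}x:=\log(\log_{k-1}x)$ for $k\in\mathbb{N}$ ($x$ large enough). Empty sums equal $0$ and empty products equal $1$. $\mathbb{N}=\{1,2,\dots\}$, $\mathbb{N}_0=\mathbb{N}\cup\{0\}$. *)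

(* Defs.v *)
From mathcomp Require Import all_boot all_order all_algebra.
From mathcomp Require Import all_classical all_reals all_analysis.
From mathcomp Require Import complex.

Set Implicit Arguments.
Unset Strict Implicit.
Unset Printing Implicit Defensive.

Import Order.TTheory GRing.Theory Num.Theory.
Import numFieldNormedType.Exports.

Local Open Scope classical_set_scope.
Local Open Scope ring_scope.
Local Open Scope complex_scope.

(** The lattice Z^d is ['rV[int]_d].  Vectors of l^2(Z^d) are plain functions on Z^d;
    membership in l^2 and in operator domains is expressed by predicates. *)

(** The Euclidean norm (the library norm on row vectors is the sup norm). *)
Definition enorm (R : realType) (d : nat) (n : 'rV[int]_d) : R :=
  Num.sqrt (\sum_(j < d) (n ord0 j)%:~R ^+ 2).

Definition basisv (d : nat) (j : 'I_d) : 'rV[int]_d := delta_mx ord0 j.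

(** log_0 x = x and log_k x = log (log_(k-1) x).  As [ln] is total, this is the
    genuine iterated logarithm only for large x. *)
Definition ilog (R : realType) (k : nat) (x : R) : R := iter k (@ln R) x.

(** Extended-real valued: equal to +oo exactly outside l^2(Z^d). *)
Definition l2norm (R : realType) (d : nat) (psi : 'rV[int]_d -> R[i]) : \bar R :=
  sqrte (\esum_(n in [set: 'rV[int]_d]) (Normc.normc (psi n) ^+ 2)%:E).

Definition l2 (R : realType) (d : nat) : set ('rV[int]_d -> R[i]) :=
  [set psi | (l2norm psi < +oo)%E].
Arguments l2 : clear implicits.

(** A possibly unbounded operator; only the values of [act] on [dom] matter. *)
Record operator (R : realType) (d : nat) := Operator {
  dom : set ('rV[int]_d -> R[i]) ;
  act : ('rV[int]_d -> R[i]) -> ('rV[int]_d -> R[i]) }.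

Definition op_add (R : realType) (d : nat) (A B : operator R d) : operator R d :=
  Operator (dom A `&` dom B) (fun psi n => act A psi n + act B psi n).

(** -Delta; the index set of the sum is finite, so the finitely supported sum
    [\sum_(m \in _)] is the ordinary sum over the neighbours of n. *)
Definition laplacian (R : realType) (d : nat) : operator R d :=
  Operator (l2 R d)
    (fun psi n => \sum_(m \in [set m : 'rV[int]_d | enorm R (m - n) = 1])
                    (psi n - psi m)).
Arguments laplacian : clear implicits.

Definition mult_op (R : realType) (d : nat) (V : 'rV[int]_d -> R) : operator R d :=
  Operator [set psi | l2 R d psi /\ l2 R d (fun n => (V n)%:C * psi n)]
           (fun psi n => (V n)%:C * psi n).

Definition schrodinger (R : realType) (d : nat) (V : 'rV[int]_d -> R) : operator R d :=
  op_add (laplacian R d) (mult_op V).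

Definition op_shift (R : realType) (d : nat) (A : operator R d) (z : R[i])
    (psi : 'rV[int]_d -> R[i]) : 'rV[int]_d -> R[i] :=
  fun n => act A psi n - z * psi n.

(** z such that A - z : dom A -> l^2(Z^d) has an everywhere defined bounded inverse B. *)
Definition resolvent_set (R : realType) (d : nat) (A : operator R d) : set R[i] :=
  [set z | exists B : ('rV[int]_d -> R[i]) -> ('rV[int]_d -> R[i]),
     [/\ exists M : R, forall phi, l2 R d phi ->
           (l2norm (B phi) <= M%:E * l2norm phi)%E,
         forall phi, l2 R d phi ->
           dom A (B phi) /\ op_shift A z (B phi) = phi
       & forall psi, dom A psi -> B (op_shift A z psi) = psi]].

Definition spectrum (R : realType) (d : nat) (A : operator R d) : set R[i] :=
  ~` resolvent_set A.

Definition eigenspace_op (R : realType) (d : nat) (A : operator R d) (z : R[i]) :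
    set ('rV[int]_d -> R[i]) :=
  [set psi | dom A psi /\ act A psi = (fun n => z * psi n)].

Definition point_spectrum (R : realType) (d : nat) (A : operator R d) : set R[i] :=
  [set z | exists2 psi, eigenspace_op A z psi & psi <> (fun=> 0)].

Definition finite_multiplicity (R : realType) (d : nat) (A : operator R d) (z : R[i]) :=
  exists (k : nat) (f : 'I_k -> 'rV[int]_d -> R[i]),
    forall psi, eigenspace_op A z psi ->
      exists c : 'I_k -> R[i], psi = (fun n => \sum_(i < k) c i * f i n).

(** The discrete spectrum consists of the eigenvalues of finite multiplicity that
    are isolated points of the spectrum; [R[i]^o] carries the topology of C. *)
Definition discrete_spectrum (R : realType) (d : nat) (A : operator R d) : set R[i] :=
  [set z | [/\ point_spectrum A z, finite_multiplicity A z
             & isolated (spectrum A : set R[i]^o) z]].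

(** The definition for self-adjoint operators: complement of the discrete spectrum. *)
Definition essential_spectrum (R : realType) (d : nat) (A : operator R d) : set R[i] :=
  spectrum A `\` discrete_spectrum A.

(** Supremum in [-oo, +oo] of a set of real spectral values.  It is only applied
    to spectra of self-adjoint operators, which are contained in R. *)
Definition sup_real (R : realType) (S : set R[i]) : \bar R :=
  ereal_sup [set x%:E | x in [set x : R | S x%:C]].

(** T is everywhere defined and maps every bounded sequence to one with a
    subsequence converging in l^2(Z^d). *)
Definition compact_op (R : realType) (d : nat) (T : operator R d) : Prop :=
  l2 R d `<=` dom T /\
  forall u : nat -> 'rV[int]_d -> R[i],
    (exists M : R, forall k, (l2norm (u k) <= M%:E)%E) ->
    exists2 p : nat -> nat, {homo p : i j / (i < j)%N} &
      exists2 v, l2 R d v &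
        (fun k => l2norm (fun n => act T (u (p k)) n - v n)) @ \oo --> 0%E.

(** [schrodinger V] is critical at s from above.  Boundedness from above is encoded
    by the supremum of the spectrum being the real number s. *)
Definition critical_from_above (R : realType) (d : nat) (V : 'rV[int]_d -> R) (s : R)
    : Prop :=
  sup_real (spectrum (schrodinger V)) = s%:E /\
  forall W : 'rV[int]_d -> R,
    (forall n, 0 <= W n) -> compact_op (mult_op W) ->
    sup_real (spectrum (op_add (schrodinger V) (mult_op W))) = s%:E ->
    forall n, W n = 0.

(* Main.v *)
(* The sign flip [u n -> (-1) ^ (n_1 + ... + n_d) u n] turns [4d - H_V] into the
   operator [tq q u n = q n * u n - (sum of u over the neighbours of n)] with
   [q = 2d - V], whose resolvents at negative energies are positivity preserving.
   That sup sigma(H_V) <= 4d makes all [tq (q + k)], k > 0, boundedly invertible, and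
   normalised Green's functions converge, as k tends to 0, to a positive
   supersolution u.  Criticality forces every positive supersolution to be a
   solution: otherwise part of its excess at one point could be moved into a
   rank-one potential W >= 0 without raising the supremum of the spectrum.  The
   hypothesis on V says that
     g(n) = |n|^(-d/2) * \prod_(i <= s) (log_i |n|)^(-1/2) * (log_s |n|)^(-eps)
   is a supersolution near infinity.  Then min(u, C g) outside a large ball, glued
   to u inside, is a positive supersolution, hence a solution; it is square summable
   because g is, and undoing the sign flip gives the eigenvector.  The second
   condition implies the first one, with a smaller eps, by a Taylor expansion of g. *)
Require Import Defs.
From mathcomp Require Import all_boot all_order all_algebra.
From mathcomp Require Import all_classical all_reals all_analysis.
From mathcomp Require Import complex ring lra zify.

Set Implicit Arguments.
Unset Strict Implicit.
Unset Printing Implicit Defensive.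

Import Order.TTheory GRing.Theory Num.Theory.
Import numFieldNormedType.Exports.
Local Open Scope classical_set_scope.
Local Open Scope ring_scope.
Local Open Scope complex_scope.

(** * Summable real families *)

Section RealSums.
Context {R : realType} {T : choiceType}.
Implicit Types f g h : T -> R.

(** No functional calculus is used: nonnegativity of the quadratic form of [tq q] is extracted from
    the mere existence of bounded inverses at the energies [- k], [k > 0]. Positive [k] cannot be
    avoided, as [tq q] itself need not be invertible; hence every estimate that has to survive
    [k -> 0] must be uniform in [k], and the Harnack inequality and the choice of the point mass are
    made for this. The role of [eps > 0] is summability: up to a constant, the sum of [g^2] over the
    shell of radius [r] is [1 / (r log r ... log_s r)] times [(log_s r)^(- 2 eps)], the derivative
    of a bounded function. The constant [d (4 - d) / 4] arises as follows. If [g] decays locally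
    like [r^(- A)], then [r^2 (nbsum g / g - 2 d)] is [A^2 + 2 A - d A] to leading order. With
    [A = d / 2 + sigma] this is [d (4 - d) / 4 + 2 sigma + sigma^2]. Here [2 sigma] reproduces the
    series of logarithmic products in the second condition, while [sigma^2] and the Taylor
    remainders have to be absorbed by its last term. *)

Definition summ f : Prop := (\esum_(n in [set: T]) `|f n|%:E < +oo)%E.

(** [fine] sends an infinite sum to 0, which is why the rules below carry [summ] hypotheses. *)
Definition psum f : R := fine (\esum_(n in [set: T]) (f n)%:E)%E.

Definition rsum f : R :=
  psum (fun n => Num.max (f n) 0) - psum (fun n => Num.max (- f n) 0).

Lemma summ_le f g : (forall n, `|f n| <= g n) -> summ g -> summ f.
Proof.
move=> fg; apply: le_lt_trans; apply: le_esum => n _.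
by rewrite lee_fin (le_trans (fg n))// ler_norm.
Qed.

Lemma summ_norm f : summ f -> summ (fun n => `|f n|).
Proof. by apply: le_lt_trans; apply: le_esum => n _; rewrite normr_id. Qed.

Lemma summD f g : summ f -> summ g -> summ (fun n => f n + g n).
Proof.
move=> sf sg; rewrite /summ.
apply: (@le_lt_trans _ _ (\esum_(n in [set: T]) (`|f n|%:E + `|g n|%:E))%E).
  by apply: le_esum => n _; rewrite -EFinD lee_fin ler_normD.
by rewrite esumD ?lte_add_pinfty// => n _; rewrite lee_fin.
Qed.

Lemma psum_fin f : (forall n, 0 <= f n) -> summ f ->
  (psum f)%:E = (\esum_(n in [set: T]) (f n)%:E)%E.
Proof.
move=> f0; rewrite /summ /psum.
rewrite (eq_esum (b := fun n => (f n)%:E)); last by move=> n _; rewrite ger0_norm.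
by move=> fo; rewrite fineK// ge0_fin_numE// esum_ge0// => n _; rewrite lee_fin.
Qed.

Lemma psum_ge0 f : (forall n, 0 <= f n) -> 0 <= psum f.
Proof. by move=> f0; rewrite fine_ge0// esum_ge0// => n _; rewrite lee_fin. Qed.

Lemma psumD f g : (forall n, 0 <= f n) -> (forall n, 0 <= g n) ->
  summ f -> summ g -> psum (fun n => f n + g n) = psum f + psum g.
Proof.
move=> f0 g0 sf sg; apply: EFin_inj; rewrite EFinD !psum_fin//.
- by rewrite -esumD// => n _; rewrite lee_fin.
- by move=> n; rewrite addr_ge0.
- exact: summD.
Qed.

Lemma ge_psum1 f n : (forall n, 0 <= f n) -> summ f -> f n <= psum f.
Proof.
move=> f0 sf; rewrite -lee_fin psum_fin//.
apply: ereal_sup_ubound; exists [set n]; first by split; [exact: finite_set1|].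
by rewrite fsbig_set1.
Qed.

Lemma esumZ_le (c : R) f : 0 <= c -> (forall n, 0 <= f n) ->
  (\esum_(n in [set: T]) (c * f n)%:E <= c%:E * \esum_(n in [set: T]) (f n)%:E)%E.
Proof.
move=> c0 f0; apply: ge_ereal_sup => _ [A /= [finA _] <-].
rewrite fsumEFin// -mulr_fsumr EFinM lee_wpmul2l ?lee_fin//.
by rewrite -fsumEFin//; apply: ereal_sup_ubound; exists A.
Qed.

Lemma summZ (c : R) f : summ f -> summ (fun n => c * f n).
Proof.
move=> sf; rewrite /summ (eq_esum (b := fun n => (`|c| * `|f n|)%:E)); last first.
  by move=> n _; rewrite normrM.
apply: le_lt_trans (@esumZ_le `|c| (fun n => `|f n|) _ _) _ => //.
by rewrite lte_mul_pinfty// lee_fin.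
Qed.

Lemma psumZ (c : R) f : 0 <= c -> (forall n, 0 <= f n) -> summ f ->
  psum (fun n => c * f n) = c * psum f.
Proof.
have le (k : R) g : 0 <= k -> (forall n, 0 <= g n) -> summ g ->
    psum (fun n => k * g n) <= k * psum g.
  move=> k0 g0 sg; rewrite -lee_fin EFinM !psum_fin ?esumZ_le//.
  - by move=> n; rewrite mulr_ge0.
  - exact: summZ.
rewrite le_eqVlt => /predU1P[<- f0 sf|c0 f0 sf].
  rewrite mul0r; apply/eqP; rewrite eq_le psum_ge0 ?andbT.
    by have := le 0 f (lexx 0) f0 sf; rewrite mul0r.
  by move=> n; rewrite mul0r.
(* The reverse inequality is the first one, applied with the factor [c^-1]. *)
apply/eqP; rewrite eq_le le ?(ltW c0)//=.
have := le c^-1 (fun n => c * f n); rewrite invr_ge0 (ltW c0) => /(_ isT).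
rewrite ler_pdivlMl// (_ : (fun n => c^-1 * _) = f); last first.
  by apply/funext => n; rewrite mulKf ?gt_eqF.
apply; last exact: summZ.
by move=> n; rewrite mulr_ge0// ltW.
Qed.

Lemma summ_max f : summ f -> summ (fun n => Num.max (f n) 0).
Proof.
move=> /summ_norm; apply: summ_le => n.
by rewrite ger0_norm ?le_max ?lexx ?orbT// ge_max ler_norm normr_ge0.
Qed.

Lemma summN f : summ f -> summ (fun n => - f n).
Proof. by move=> /summ_norm; apply: summ_le => n; rewrite normrN. Qed.

(** Positive parts are not additive, but [f = g - h] gives [f^+ + h = f^- + g], a relation between
    nonnegative families. This freedom in the splitting makes [rsum] linear. *)
Lemma rsum_psumB f g h : (forall n, 0 <= g n) -> (forall n, 0 <= h n) ->
  summ g -> summ h -> (forall n, f n = g n - h n) -> rsum f = psum g - psum h.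
Proof.
move=> g0 h0 sg sh fE.
have sf : summ f.
  by rewrite (_ : f = fun n => g n + (- h n)); [exact/summD/summN|apply/funext].
have max0 (x : R) : 0 <= Num.max x 0 by rewrite le_max lexx orbT.
apply/eqP; rewrite /rsum subr_eq addrAC eq_sym subr_eq; apply/eqP.
rewrite -!psumD//; [congr psum; apply/funext => n| |]; last 2 first.
- exact: summ_max.
- exact/summ_max/summN.
by rewrite fE; case: (leP (g n - h n) 0) => ?; case: (leP (- (g n - h n)) 0) => ?; lra.
Qed.

Lemma summ0 : summ (fun=> 0).
Proof. by rewrite /summ esum1// => n _; rewrite normr0. Qed.

Lemma psum0 : psum (fun=> 0) = 0.
Proof. by rewrite /psum esum1. Qed.

Lemma rsumE f : (forall n, 0 <= f n) -> summ f -> rsum f = psum f.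
Proof.
move=> f0 sf; rewrite (@rsum_psumB f f (fun=> 0))//.
- by rewrite psum0 subr0.
- exact: summ0.
- by move=> n; rewrite subr0.
Qed.

Lemma rsum0 : rsum (fun=> 0) = 0.
Proof. by rewrite rsumE ?psum0//; exact: summ0. Qed.

Lemma rsumD f g : summ f -> summ g -> rsum (fun n => f n + g n) = rsum f + rsum g.
Proof.
move=> sf sg; pose p (f : T -> R) n := Num.max (f n) 0.
have max0 (x : R) : 0 <= Num.max x 0 by rewrite le_max lexx orbT.
rewrite (@rsum_psumB _ (fun n => p f n + p g n)
  (fun n => p (fun n => - f n) n + p (fun n => - g n) n)) /p.
- rewrite !psumD ?/rsum//; [lra|exact/summ_max/summN..|exact/summ_max|exact/summ_max].
- by move=> n; rewrite addr_ge0.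
- by move=> n; rewrite addr_ge0.
- by apply: summD; exact: summ_max.
- by apply: summD; exact/summ_max/summN.
- move=> n; case: (leP (f n) 0) => ?; case: (leP (- f n) 0) => ?;
  case: (leP (g n) 0) => ?; case: (leP (- g n) 0) => ?; lra.
Qed.

Lemma rsumN f : rsum (fun n => - f n) = - rsum f.
Proof. by rewrite /rsum opprB; under [X in _ - psum X]eq_fun do rewrite opprK. Qed.

Lemma rsumZ (c : R) f : summ f -> rsum (fun n => c * f n) = c * rsum f.
Proof.
have max0 (x : R) : 0 <= Num.max x 0 by rewrite le_max lexx orbT.
have pos k g : 0 <= k -> summ g -> rsum (fun n => k * g n) = k * rsum g.
  move=> k0 sg; rewrite (@rsum_psumB _ (fun n => k * Num.max (g n) 0)
    (fun n => k * Num.max (- g n) 0)).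
  - by rewrite !psumZ ?mulrBr//; [exact/summ_max/summN|exact/summ_max].
  - by move=> n; rewrite mulr_ge0.
  - by move=> n; rewrite mulr_ge0.
  - exact/summZ/summ_max.
  - exact/summZ/summ_max/summN.
  - by move=> n; case: (leP (g n) 0) => ?; case: (leP (- g n) 0) => ?; nra.
move=> sf; have [c0|c0] := leP 0 c; first exact: pos.
rewrite -[c * rsum f]opprK -mulNr -pos ?oppr_ge0 ?(ltW c0)// -rsumN.
by congr rsum; apply/funext => n; rewrite mulNr opprK.
Qed.

Lemma rsum_ge0 f : (forall n, 0 <= f n) -> summ f -> 0 <= rsum f.
Proof. by move=> f0 sf; rewrite rsumE// psum_ge0. Qed.

Lemma rsum_le0 f : (forall n, f n <= 0) -> summ f -> rsum f <= 0.
Proof.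
move=> f0 sf; rewrite -oppr_ge0 -rsumN rsum_ge0//; last exact: summN.
by move=> n; rewrite oppr_ge0.
Qed.

Lemma ge_rsum1 f n : (forall n, 0 <= f n) -> summ f -> f n <= rsum f.
Proof. by move=> f0 sf; rewrite rsumE// ge_psum1. Qed.

Lemma summ_reindex (e : T -> T) f : bijective e -> summ f -> summ (f \o e).
Proof.
move=> be; rewrite /summ (@reindex_esum R T T setT setT e)//.
by rewrite setTT_bijective.
Qed.

Lemma rsum_reindex (e : T -> T) f : bijective e -> rsum (f \o e) = rsum f.
Proof.
move=> be; rewrite /rsum /psum; congr (fine _ - fine _); apply/esym.
- by rewrite (@reindex_esum R T T setT setT e)// ?setTT_bijective.
- by rewrite (@reindex_esum R T T setT setT e)// ?setTT_bijective.
Qed.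

End RealSums.

(** * The operator [tq] on real sequences *)

Section LatticeOperators.
Context {R : realType} {d : nat}.
Local Notation Zd := 'rV[int]_d.
Implicit Types u v w f q : Zd -> R.

Definition l2r u : Prop := summ (fun n => u n ^+ 2).

Definition ip u v : R := rsum (fun n => u n * v n).

Definition lin (a : R) u (b : R) v : Zd -> R := fun n => a * u n + b * v n.

Definition nbsum u (n : Zd) : R :=
  \sum_(j < d) (u (n + basisv j) + u (n - basisv j)).

Definition tq q u (n : Zd) : R := q n * u n - nbsum u n.

Definition dq q u : Prop := l2r u /\ l2r (fun n => q n * u n).

Lemma l2r_le u v : (forall n, `|u n| <= `|v n|) -> l2r v -> l2r u.
Proof.
move=> uv; apply: summ_le => n; rewrite ger0_norm ?sqr_ge0//.
by rewrite -(real_normK (num_real (u n))) -(real_normK (num_real (v n))) lerXn2r ?nnegrE.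
Qed.

Lemma l2r_mul u v : l2r u -> l2r v -> summ (fun n => u n * v n).
Proof.
move=> lu lv; apply: summ_le (summD lu lv) => n /=.
by rewrite ler_norml; apply/andP; split; nra.
Qed.

Lemma l2r_lin a u b v : l2r u -> l2r v -> l2r (lin a u b v).
Proof.
move=> lu lv; rewrite /l2r (_ : (fun n => _) = fun n => (a ^+ 2 * u n ^+ 2 +
    (2 * a * b) * (u n * v n)) + b ^+ 2 * v n ^+ 2).
  by apply: summD; [apply: summD|]; apply: summZ => //; exact: l2r_mul.
by apply/funext => n; rewrite /lin; ring.
Qed.

Lemma l2rD u v : l2r u -> l2r v -> l2r (fun n => u n + v n).
Proof.
move=> lu lv; have := l2r_lin 1 1 lu lv; congr l2r.
by apply/funext => n; rewrite /lin !mul1r.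
Qed.

Lemma l2rZ a u : l2r u -> l2r (fun n => a * u n).
Proof.
move=> lu; have := l2r_lin a 0 lu lu; congr l2r.
by apply/funext => n; rewrite /lin mul0r addr0.
Qed.

Lemma l2r0 : l2r (fun=> 0).
Proof. by rewrite /l2r; under eq_fun do rewrite expr0n; exact: summ0. Qed.

Lemma l2r_sum (I : Type) (r : seq I) (F : I -> Zd -> R) :
  (forall i, l2r (F i)) -> l2r (fun n => \sum_(i <- r) F i n).
Proof.
move=> lF; elim: r => [|i r ih].
  by under eq_fun do rewrite big_nil; exact: l2r0.
by under eq_fun do rewrite big_cons; exact: l2rD.
Qed.

Lemma bij_shift (e : Zd) : bijective (fun n => n + e).
Proof. by exists (fun n => n - e) => n; rewrite ?addrK ?subrK. Qed.

Lemma l2r_shift u e : l2r u -> l2r (fun n => u (n + e)).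
Proof. exact: (summ_reindex (bij_shift e)). Qed.

Lemma l2r_nbsum u : l2r u -> l2r (nbsum u).
Proof. by move=> lu; apply: l2r_sum => j; apply: l2rD; exact: l2r_shift. Qed.

Lemma l2r_tq q u : dq q u -> l2r (tq q u).
Proof.
move=> [lu lqu]; have := l2r_lin 1 (-1) lqu (l2r_nbsum lu); congr l2r.
by apply/funext => n; rewrite /lin /tq; ring.
Qed.

Lemma dq_shift q k u : dq q u -> dq (fun n => q n + k) u.
Proof.
move=> [lu lqu]; split=> //; have := l2r_lin 1 k lqu lu; congr l2r.
by apply/funext => n; rewrite /lin; ring.
Qed.

Lemma dq_unshift q k u : dq (fun n => q n + k) u -> dq q u.
Proof. by move=> /(dq_shift (- k)); under eq_fun do rewrite addrK. Qed.

Lemma dq_lin q a u b v : dq q u -> dq q v -> dq q (lin a u b v).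
Proof.
move=> [lu lqu] [lv lqv]; split; first exact: l2r_lin.
have := l2r_lin a b lqu lqv; congr l2r.
by apply/funext => n; rewrite /lin; ring.
Qed.

Lemma dq_le q u v : (forall n, `|u n| <= `|v n|) -> dq q v -> dq q u.
Proof.
move=> uv [lv lqv]; split; first exact: l2r_le lv.
by apply: l2r_le lqv => n; rewrite !normrM ler_wpM2l.
Qed.

Lemma nbsum_lin a u b v n : nbsum (lin a u b v) n = a * nbsum u n + b * nbsum v n.
Proof.
rewrite /nbsum !mulr_sumr -big_split; apply: eq_bigr => j _.
by rewrite /lin /=; ring.
Qed.

Lemma tq_lin q a u b v : tq q (lin a u b v) = lin a (tq q u) b (tq q v).
Proof. by apply/funext => n; rewrite /tq nbsum_lin /lin; ring. Qed.

Lemma tq_shift q k u : tq (fun n => q n + k) u = lin 1 (tq q u) k u.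
Proof. by apply/funext => n; rewrite /tq /lin; ring. Qed.

Lemma le_nbsum u v n : (forall m, u m <= v m) -> nbsum u n <= nbsum v n.
Proof. by move=> uv; apply: ler_sum => j _; rewrite lerD. Qed.

Lemma ipC u v : ip u v = ip v u.
Proof. by congr rsum; apply/funext => n; rewrite mulrC. Qed.

Lemma ip_linl a u b v w : l2r u -> l2r v -> l2r w ->
  ip (lin a u b v) w = a * ip u w + b * ip v w.
Proof.
move=> lu lv lw; have uw := l2r_mul lu lw; have vw := l2r_mul lv lw.
rewrite /ip -!rsumZ// -rsumD; [|exact: summZ..].
by congr rsum; apply/funext => n; rewrite /lin; ring.
Qed.

Lemma ip_linr a u b v w : l2r u -> l2r v -> l2r w ->
  ip w (lin a u b v) = a * ip w u + b * ip w v.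
Proof. by move=> lu lv lw; rewrite ipC ip_linl// !(ipC w). Qed.

Lemma ip_ge0 u : l2r u -> 0 <= ip u u.
Proof.
move=> lu; apply: rsum_ge0; last exact: l2r_mul.
by move=> n; rewrite -expr2 sqr_ge0.
Qed.

Lemma ip_eq0 u : l2r u -> ip u u <= 0 -> forall n, u n = 0.
Proof.
move=> lu u0 n; apply/eqP; rewrite -sqrf_eq0 eq_le sqr_ge0 andbT.
apply: le_trans u0; rewrite expr2.
apply: (@ge_rsum1 _ _ (fun n => u n * u n)); last exact: l2r_mul.
by move=> m; rewrite -expr2 sqr_ge0.
Qed.

Lemma summ_sum (I : Type) (r : seq I) (F : I -> Zd -> R) :
  (forall i, summ (F i)) -> summ (fun n => \sum_(i <- r) F i n).
Proof.
move=> sF; elim: r => [|i r ih]; last first.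
  by under eq_fun do rewrite big_cons; exact: summD.
by under eq_fun do rewrite big_nil; exact: summ0.
Qed.

Lemma rsum_sum (I : Type) (r : seq I) (F : I -> Zd -> R) :
  (forall i, summ (F i)) ->
  rsum (fun n => \sum_(i <- r) F i n) = \sum_(i <- r) rsum (F i).
Proof.
move=> sF; elim: r => [|i r ih].
  by rewrite big_nil; under eq_fun do rewrite big_nil; exact: rsum0.
rewrite big_cons -ih -rsumD//; last exact: summ_sum.
by under eq_fun do rewrite big_cons.
Qed.

(** Moving the shift by [e] to the other factor turns it into the shift by [- e], and [nbsum]
    contains both. *)
Lemma ip_nbsum u v : l2r u -> l2r v -> ip (nbsum u) v = ip u (nbsum v).
Proof.
move=> lu lv.
have sh e (x y : Zd -> R) : rsum (fun n => x (n + e) * y n) =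
    rsum (fun n => x n * y (n - e)).
  rewrite -[RHS](rsum_reindex _ (bij_shift e)); congr rsum; apply/funext => n /=.
  by rewrite addrK.
have L x y : l2r x -> l2r y -> ip (nbsum x) y =
    \sum_(j < d) (rsum (fun n => x (n + basisv j) * y n) +
                  rsum (fun n => x (n - basisv j) * y n)).
  move=> lx ly; rewrite /ip /nbsum.
  under eq_fun do rewrite mulr_suml.
  have sxy e : summ (fun n => x (n + e) * y n) by exact/l2r_mul/ly/l2r_shift.
  rewrite rsum_sum => [|j].
    apply: eq_bigr => j _; rewrite -rsumD//; congr rsum.
    by apply/funext => n; rewrite mulrDl.
  by under eq_fun do rewrite mulrDl; exact: summD.
rewrite L// ipC L//; apply: eq_bigr => j _; rewrite addrC.
by congr (_ + _); rewrite sh ?opprK; congr rsum; apply/funext => n;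
  rewrite mulrC ?opprK.
Qed.

Local Hint Extern 0 (l2r _) => solve [auto using l2r_lin, l2r_nbsum, l2r_tq] : core.

Lemma tq_sym q u v : dq q u -> dq q v -> ip (tq q u) v = ip u (tq q v).
Proof.
move=> [lu lqu] [lv lqv].
have tE w : tq q w = lin 1 (fun n => q n * w n) (-1) (nbsum w).
  by apply/funext => n; rewrite /tq /lin; ring.
rewrite !tE ip_linl// ip_linr// ip_nbsum//; congr (_ * _ + _).
by congr rsum; apply/funext => n; ring.
Qed.

(** The bound compares squared norms and also yields injectivity, so that this is membership of 0 in
    the resolvent set of [tq q] on its maximal domain. *)
Definition boundedly_invertible q : Prop :=
  (forall f, l2r f -> exists u, dq q u /\ tq q u = f) /\
  exists2 M, 0 <= M & forall u, dq q u -> ip u u <= M * ip (tq q u) (tq q u).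

(* With G the inverse of [tq q], let [-m < 0] be the infimum of the numerical
   range of G.  Then [-m] lies in the spectrum of G, so that [tq q + 1/m] is not
   boundedly invertible. *)
Lemma form_ge0_of_invertible q :
  (forall k, 0 <= k -> boundedly_invertible (fun n => q n + k)) ->
  forall u, dq q u -> 0 <= ip u (tq q u).
Proof.
move=> invq.
have [surj [M M0 bd]] : boundedly_invertible q.
  by have := invq 0 (lexx 0); under eq_fun do rewrite addr0.
(* Writing [u = G f] with [f = tq q u], membership of [m] says that the form of [G + m] is
   nonnegative. *)
pose E := [set m : R | 0 <= m /\ forall u, dq q u ->
  0 <= ip u (tq q u) + m * ip (tq q u) (tq q u)].
(* Expand the squared norm of [u + tq q u] and bound that of [u] by [bd]. *)
have EM : E ((M + 1) / 2).
  split=> [|u du]; first by lra.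
  have lt := l2r_tq du; have lu : l2r u by case: du.
  have := ip_ge0 (l2r_lin 1 1 lu lt).
  rewrite ip_linl// ?ip_linr// (ipC (tq q u) u).
  by have := bd _ du; nra.
have infE : has_inf E by split; [exists ((M + 1) / 2)|exists 0 => m []].
have m0 : 0 <= inf E by apply: lb_le_inf; [exact: infE.1|move=> m []].
have inE : E (inf E).
  (* The infimum is attained: a strict failure at [inf E] for one [u] would persist at members of
     [E] slightly above it. The [+ 1] in the denominator avoids dividing by zero. *)
  split=> // u du; rewrite leNgt; apply/negP => lt0.
  have n0 : 0 <= ip (tq q u) (tq q u) by apply/ip_ge0/l2r_tq.
  set a := ip u (tq q u) in lt0 *; set b := ip (tq q u) (tq q u) in n0 lt0 *.
  pose e := - (a + inf E * b) / (b + 1).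
  have e0 : 0 < e by rewrite divr_gt0//; lra.
  have eb : e * (b + 1) = - (a + inf E * b) by rewrite divfK// gt_eqF//; lra.
  have [m [_ /(_ _ du)]] := inf_adherent e0 infE; rewrite -/a -/b => Em mlt.
  have : m * b <= (inf E + e) * b by rewrite ler_wpM2r// ltW.
  nra.
have [m_le0|m_gt0] := leP (inf E) 0.
  have E0 : inf E = 0 by apply/eqP; rewrite eq_le m_le0.
  by move: inE; rewrite E0 => -[_ inE] u /inE; rewrite mul0r addr0.
set m := inf E in m0 inE m_gt0; case: inE => _ mform.
pose C := (M + 1) / 2 + m + 1.
have C0 : 0 < C by rewrite /C; lra.
(* This is [F^2 <= C F] for [F = G + m]: with [z = F f], the nonnegative form of [F] is evaluated at
   [f - C^-1 z]; [v] below is [G z]. *)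
have key u : dq q u -> ip (lin 1 u m (tq q u)) (lin 1 u m (tq q u)) <=
    C * (ip u (tq q u) + m * ip (tq q u) (tq q u)).
  move=> du; have lt := l2r_tq du; have lu : l2r u by case: du.
  have [z zE] : exists z, z = lin 1 u m (tq q u) by eexists.
  rewrite -zE; have lz : l2r z by rewrite zE.
  have [v [dv vz]] := surj _ lz; have lv : l2r v by case: dv.
  set X := ip z z; have X0 : 0 <= X by exact: ip_ge0.
  have vX : ip v (tq q v) + m * ip (tq q v) (tq q v) <= C * X.
    rewrite vz -/X; have := ip_ge0 (l2r_lin 1 (-1) lv lz).
    rewrite ip_linl// ?ip_linr// (ipC z v) -/X.
    by have := bd _ dv; rewrite vz -/X /C; lra.
  have uvX : ip u (tq q v) + m * ip (tq q u) (tq q v) = X.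
    by rewrite vz /X {3}zE ip_linl// ?mul1r.
  have uvX' : ip v (tq q u) = ip u (tq q v) by rewrite ipC tq_sym.
  have := mform _ (dq_lin 1 (- C^-1) du dv).
  have lTv : l2r (tq q v) by rewrite vz.
  rewrite tq_lin !ip_linl// ?ip_linr// uvX' (ipC (tq q v) (tq q u)).
  set a := ip u (tq q u); set b := ip (tq q u) (tq q u).
  set a' := ip v (tq q v) in vX *; set b' := ip (tq q v) (tq q v) in vX *.
  move=> H; have {}H : 0 <= (a + m * b) - 2 * C^-1 * X + C^-1 ^+ 2 * (a' + m * b').
    by move: H; rewrite -uvX; lra.
  have C1 : C * C^-1 = 1 by rewrite divff ?gt_eqF.
  have c0 : 0 < C^-1 by rewrite invr_gt0.
  have : C^-1 ^+ 2 * (a' + m * b') <= C^-1 ^+ 2 * (C * X) by rewrite ler_wpM2l ?sqr_ge0.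
  rewrite (_ : C^-1 ^+ 2 * (C * X) = C^-1 * X); last by rewrite expr2 -!mulrA mulKf ?gt_eqF.
  move=> H2; rewrite -ler_pdivrMl//; lra.
have mi0 : 0 < m^-1 by rewrite invr_gt0.
(* Since [(tq q + 1/m) u = z / m], invertibility at [1/m] bounds [u] by [z], and hence also
   [tq q u = (z - u) / m]. With [key] this bounds the form of [G + m] below by some [e > 0], so that
   [m] can be lowered. *)
have [_ [M' M'0 bd']] := invq m^-1 (ltW mi0).
have [e e0 small] : exists2 e, 0 < e & forall u, dq q u ->
    e * ip (tq q u) (tq q u) <= ip u (tq q u) + m * ip (tq q u) (tq q u).
  pose K := 2 * (m^-1 ^+ 2) * (1 + M' * m^-1 ^+ 2) * C + 1.
  have K0 : 0 < K.
    rewrite /K ltr_wpDl// mulr_ge0 ?(ltW C0)// mulr_ge0//.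
      by rewrite mulr_ge0 ?sqr_ge0.
    by rewrite addr_ge0// mulr_ge0 ?sqr_ge0.
  exists K^-1; first by rewrite invr_gt0.
  move=> u du; rewrite ler_pdivrMl//.
  have lt := l2r_tq du; have lu : l2r u by case: du.
  have [z zE] : exists z, z = lin 1 u m (tq q u) by eexists.
  have lz : l2r z by rewrite zE.
  have := bd' u (dq_shift _ du).
  rewrite tq_shift (_ : lin 1 (tq q u) m^-1 u = lin m^-1 z 0 z); last first.
    by apply/funext => n; rewrite zE /lin; field; rewrite gt_eqF.
  rewrite ip_linl// !ip_linr// !mul0r !addr0 mulrA -expr2 => uz.
  have TE : tq q u = lin m^-1 z (- m^-1) u.
    by apply/funext => n; rewrite zE /lin; field; rewrite gt_eqF.
  have zz := key _ du; rewrite -zE in zz.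
  have : ip (tq q u) (tq q u) <= 2 * m^-1 ^+ 2 * (ip z z + ip u u).
    rewrite TE ip_linl// ?ip_linr// (ipC u z).
    have := ip_ge0 (l2r_lin 1 1 lz lu).
    rewrite ip_linl// ?ip_linr// (ipC u z) => H.
    have := mulr_ge0 (sqr_ge0 m^-1) H; lra.
  move=> H1; apply: le_trans H1 _.
  set F := ip u _ + _; have F0 : 0 <= F by exact: mform.
  have H3 : ip z z + ip u u <= (1 + M' * m^-1 ^+ 2) * (C * F).
    apply: le_trans (_ : (1 + M' * m^-1 ^+ 2) * ip z z <= _); first by lra.
    by rewrite ler_wpM2l// addr_ge0// mulr_ge0// sqr_ge0.
  have H4 : 2 * m^-1 ^+ 2 * (ip z z + ip u u) <=
     2 * m^-1 ^+ 2 * ((1 + M' * m^-1 ^+ 2) * (C * F)).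
    by rewrite ler_wpM2l// mulr_ge0 ?sqr_ge0.
  by apply: le_trans H4 _; rewrite /K; lra.
(* The minimum with [m] keeps [m - e'] nonnegative, as [E] requires. *)
pose e' := Num.min e m.
have e'0 : 0 < e' by rewrite lt_min e0.
have : E (m - e').
  split; first by rewrite subr_ge0 ge_min lexx orbT.
  move=> u du; have := small u du.
  have : e' * ip (tq q u) (tq q u) <= e * ip (tq q u) (tq q u).
    by rewrite ler_wpM2r ?ge_min ?lexx// ip_ge0// l2r_tq.
  by lra.
move=> /(ge_inf (infE.2)); rewrite -/m; lra.
Qed.

(** Energy 0 is excluded here, so the preceding lemma is applied to [q + k], with [k] so small that
    [k <u, u>] cannot compensate a negative value of the form at [u]. *)
Lemma form_ge0 q :
  (forall k, 0 < k -> boundedly_invertible (fun n => q n + k)) ->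
  forall u, dq q u -> 0 <= ip u (tq q u).
Proof.
move=> invq u du; have lu : l2r u by case: du.
rewrite leNgt; apply/negP => lt0.
have u0 : 0 <= ip u u by exact: ip_ge0.
pose k := - ip u (tq q u) / (2 * (ip u u + 1)).
have k0 : 0 < k by rewrite divr_gt0; lra.
have inv' k' : 0 <= k' -> boundedly_invertible (fun n => q n + k + k').
  by move=> k'0; under eq_fun do rewrite -addrA; apply: invq; lra.
have := form_ge0_of_invertible inv' (dq_shift k du).
rewrite tq_shift ip_linr//.
have : k * ip u u <= - ip u (tq q u) / 2.
  rewrite /k invfM mulrA -[leRHS]mulr1 -[leLHS]mulrA ler_wpM2l//; first by lra.
  by rewrite mulrC ler_pdivrMr; lra.
lra.
Qed.

(** Weak maximum principle, tested with [p = max (u - w) 0]: the off-diagonal entries are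
    nonpositive, so [tq p <= tq (u - w) <= 0] wherever [p > 0], while the form of the shifted
    operator at [p] is at least [k <p, p>]. As [w >= 0] gives [p <= |u|], the function [w] may lie
    outside l^2. *)
Lemma comparison q k u w :
  (forall v, dq q v -> 0 <= ip v (tq q v)) -> 0 < k -> dq q u ->
  (forall n, 0 <= w n) ->
  (forall n, w n < u n ->
     tq (fun n => q n + k) u n <= tq (fun n => q n + k) w n) ->
  forall n, u n <= w n.
Proof.
move=> form k0 du w0 uw; pose p n := Num.max (u n - w n) 0.
have dp : dq q p.
  apply: dq_le du => n; rewrite /p; have := w0 n.
  have [h|h] := leP (u n - w n) 0; first by rewrite normr0.
  by move=> wn; rewrite !ger0_norm; lra.
have lp : l2r p by case: dp.
suff p0 : ip p p <= 0.
  move=> n; have := ip_eq0 lp p0 n; rewrite /p.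
  by have [h _|h h'] := leP (u n - w n) 0; lra.
have ltp := l2r_tq (dq_shift k dp).
have : ip p (tq (fun n => q n + k) p) <= 0.
  apply: rsum_le0; last exact: l2r_mul lp ltp.
  move=> n; rewrite [X in X * _]/p.
  have [h|h] := leP (u n - w n) 0; first by rewrite mul0r.
  rewrite pmulr_rle0//.
  apply: (@le_trans _ _ (tq (fun n => q n + k) (lin 1 u (-1) w) n)); last first.
    by rewrite tq_lin /lin; have := uw n; lra.
  rewrite /tq; apply: lerB.
    by rewrite /p /lin max_l; [lra|exact: ltW].
  apply: le_nbsum => m; rewrite /lin mul1r mulN1r.
  by rewrite /p le_max lexx.
rewrite tq_shift ip_linr//.
by have := form _ dp; nra.
Qed.

End LatticeOperators.

(** * Positivity, rank-one perturbations and the Harnack inequality *)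

Section PositiveSolutions.
Context {R : realType} {d : nat}.
Local Notation Zd := 'rV[int]_d.
Implicit Types u v w f g q : Zd -> R.

Definition dirac_fun (n0 : Zd) : Zd -> R := fun n => (n == n0)%:R.

Lemma l2r_dirac n0 : l2r (dirac_fun n0).
Proof.
rewrite /l2r /summ (eq_esum (b := fun n => if n \in [set n0] then 1%:E else 0%E)).
  by rewrite -esum_mkcondr setTI esum_set1// ?ltry// lee_fin.
move=> n _; rewrite /dirac_fun; case: eqVneq => [->|nn0].
  by rewrite mem_set//= expr1n normr1.
by rewrite memNset ?expr0n ?normr0//=; exact/eqP.
Qed.

Lemma resolvent_ge0 q k u : (forall v, dq q v -> 0 <= ip v (tq q v)) ->
  0 < k -> dq q u -> (forall n, 0 <= tq (fun n => q n + k) u n) ->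
  forall n, 0 <= u n.
Proof.
move=> form k0 du tu0 n.
suff : lin (-1) u 0 u n <= 0 by rewrite /lin; lra.
apply: (@comparison _ _ q k _ (fun=> 0) form k0) => // [|m _]; first exact: dq_lin.
rewrite tq_lin /lin [leRHS]/tq /nbsum big1; first by have := tu0 m; lra.
by move=> j _; rewrite addr0.
Qed.

Lemma dq_dirac q a n0 u : dq q u -> dq (fun n => q n - a * dirac_fun n0 n) u.
Proof.
move=> [lu lqu]; split=> //.
have := l2r_lin 1 (- a * u n0) lqu (l2r_dirac n0); congr l2r.
apply/funext => n; rewrite /lin /dirac_fun; case: eqVneq => [->|_] /=; ring.
Qed.

(** Sherman-Morrison formula: [g] is the Green's function at [n0], and [1 - a * g n0] is the
    determinant of the rank-one perturbation. *)
Lemma invertible_rank_one q a n0 g : boundedly_invertible q ->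
  dq q g -> tq q g = dirac_fun n0 -> 1 - a * g n0 != 0 ->
  boundedly_invertible (fun n => q n - a * dirac_fun n0 n).
Proof.
move=> [surj [M M0 bd]] dg gE ag0; set q' := fun n => _.
have tq'E u : tq q' u = lin 1 (tq q u) (- (a * u n0)) (dirac_fun n0).
  apply/funext => n; rewrite /tq /lin /q' /dirac_fun.
  by case: eqVneq => [->|_] /=; ring.
pose sol h : Zd -> R := lin 1 h (a * h n0 / (1 - a * g n0)) g.
have solP f h : dq q h -> tq q h = f -> tq q' (sol h) = f.
  move=> dh hE; rewrite tq'E /sol tq_lin gE hE; apply/funext => n.
  by rewrite /lin; field.
have dq' u : dq q' u -> dq q u.
  move=> /(@dq_dirac _ (- a) n0); congr dq; apply/funext => n.
  by rewrite /q'; ring.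
have inj u : dq q u -> tq q u = (fun=> 0) -> forall n, u n = 0.
  move=> du u0; apply: ip_eq0; first by case: du.
  apply: le_trans (bd _ du) _; rewrite u0 /ip.
  by under eq_fun do rewrite mul0r; rewrite rsum0 mulr0.
split=> [f /surj[h [dh hE]]|].
  exists (sol h); split; last exact: solP.
  by apply: dq_dirac; exact: dq_lin.
pose c := a / (1 - a * g n0).
exists (2 * M * (1 + c ^+ 2 * ip g g)).
  have : 0 <= ip g g by apply: ip_ge0; case: dg.
  by move=> gg; rewrite !mulr_ge0// addr_ge0// mulr_ge0// sqr_ge0.
move=> u du'; have du := dq' _ du'.
have lf := l2r_tq du'; have [h [dh hE]] := surj _ lf.
have lh : l2r h by case: dh.
have lg : l2r g by case: dg.
have uE n : u n = lin 1 h (a * u n0) g n.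
  have := inj (lin 1 u (-1) (lin 1 h (a * u n0) g)).
  rewrite tq_lin tq_lin gE hE tq'E => /(_ _ _ n) H.
  suff : lin 1 u (-1) (lin 1 h (a * u n0) g) n = 0 by rewrite /lin; lra.
  apply: H; first exact: (dq_lin _ _ du (dq_lin _ _ dh dg)).
  by apply/funext => m; rewrite /lin; ring.
(* The representation [uE] evaluated at [n0] eliminates [u n0], so that [u] is controlled by the
   unperturbed solution [h] alone. *)
have un0 : a * u n0 = c * h n0.
  have -> : h n0 = u n0 * (1 - a * g n0) by have := uE n0; rewrite /lin; lra.
  by rewrite /c; field.
have hn0 : h n0 ^+ 2 <= ip h h.
  rewrite expr2; apply: (@ge_rsum1 _ _ (fun n => h n * h n)); last exact: l2r_mul.
  by move=> m; rewrite -expr2 sqr_ge0.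
have {}uE : u = lin 1 h (c * h n0) g by apply/funext => n; rewrite uE un0.
have hf := bd _ dh; rewrite hE in hf.
apply: (@le_trans _ _ (2 * (1 + c ^+ 2 * ip g g) * ip h h)); last first.
  rewrite [leRHS](_ : _ = 2 * (1 + c ^+ 2 * ip g g) * (M * ip (tq q' u) (tq q' u))).
    rewrite ler_wpM2l// mulr_ge0// addr_ge0// mulr_ge0 ?sqr_ge0//.
    exact: ip_ge0.
  by ring.
have gg := ip_ge0 lg.
have := ip_ge0 (l2r_lin 1 (- (c * h n0)) lh lg).
have lx c' : l2r (lin 1 h c' g) by exact: l2r_lin.
rewrite {1 2}uE !ip_linl// !ip_linr// (ipC g h) => H.
have : (c * h n0) ^+ 2 * ip g g <= c ^+ 2 * ip h h * ip g g.
  by rewrite ler_wpM2r// exprMn ler_wpM2l// sqr_ge0.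
by lra.
Qed.

Lemma lattice_ind (P : Zd -> Prop) : P 0 ->
  (forall n j, P n -> P (n + basisv j)) -> (forall n j, P n -> P (n - basisv j)) ->
  forall n, P n.
Proof.
move=> P0 Pp Pm n.
have Pz m j (z : int) : P m -> P (m + z *: basisv j).
  move=> Pm0; elim: z => [|k ih|k ih]; first by rewrite scale0r addr0.
    by rewrite intS [1 + _]addrC scalerDl scale1r addrA; exact: Pp.
  by rewrite intS [1 + _]addrC opprD scalerDl scaleN1r addrA; exact: Pm.
rewrite [n]row_sum_delta; elim: (index_enum _) => [|j r ih]; first by rewrite big_nil.
by rewrite big_cons addrC; exact: Pz.
Qed.

(** Nonnegativity lets a single neighbour be bounded by the whole [nbsum], hence by [Q n * v n].
    Every edge can be crossed in both directions, so chaining along a path from 0 compares [v m] and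
    [v 0], with a constant independent of [v]. *)
Lemma harnack (Q : Zd -> R) : (forall n, 0 <= Q n) ->
  forall m, exists2 C : R, 0 < C & forall v, (forall n, 0 <= v n) ->
    (forall n, nbsum v n <= Q n * v n) -> v m <= C * v 0 /\ v 0 <= C * v m.
Proof.
move=> Q0.
have nb v n j : (forall n, 0 <= v n) -> (forall n, nbsum v n <= Q n * v n) ->
    v (n + basisv j) <= Q n * v n /\ v (n - basisv j) <= Q n * v n.
  move=> v0 /(_ n); rewrite /nbsum (bigD1 j)//= => le.
  have : 0 <= \sum_(i < d | i != j) (v (n + basisv i) + v (n - basisv i)).
    by apply: sumr_ge0 => i _; rewrite addr_ge0.
  by have := v0 (n + basisv j); have := v0 (n - basisv j); lra.
have step n m : (forall v, (forall n, 0 <= v n) ->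
      (forall n, nbsum v n <= Q n * v n) -> v m <= Q n * v n /\ v n <= Q m * v m) ->
    (exists2 C : R, 0 < C & forall v, (forall n, 0 <= v n) ->
      (forall n, nbsum v n <= Q n * v n) -> v n <= C * v 0 /\ v 0 <= C * v n) ->
    exists2 C : R, 0 < C & forall v, (forall n, 0 <= v n) ->
      (forall n, nbsum v n <= Q n * v n) -> v m <= C * v 0 /\ v 0 <= C * v m.
  move=> nm [C C0 CP]; exists (C * (Q n + Q m + 1)).
    by rewrite mulr_gt0// ltr_wpDl// addr_ge0.
  move=> v v0 vQ; have [h1 h2] := nm _ v0 vQ; have [h3 h4] := CP _ v0 vQ.
  have Qn := Q0 n; have Qm := Q0 m; have vm := v0 m; have vz := v0 0.
  split.
    apply: le_trans h1 _; apply: le_trans (ler_wpM2l Qn h3) _.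
    by rewrite mulrA ler_wpM2r// [leLHS]mulrC ler_wpM2l ?(ltW C0)//; lra.
  apply: le_trans h4 _; rewrite -mulrA ler_wpM2l ?(ltW C0)//.
  by apply: le_trans h2 _; rewrite ler_wpM2r//; lra.
apply: lattice_ind => [|n j|n j].
- by exists 1 => // v _ _; rewrite !mul1r.
- apply: step => v v0 vQ; have [h _] := nb v n j v0 vQ; split=> //.
  by have [_] := nb v (n + basisv j) j v0 vQ; rewrite addrK.
- apply: step => v v0 vQ; have [_ h] := nb v n j v0 vQ; split=> //.
  by have [] := nb v (n - basisv j) j v0 vQ; rewrite subrK.
Qed.

End PositiveSolutions.

(** * Positive supersolutions *)

Section Supersolutions.
Context {R : realType} {d : nat}.
Local Notation Zd := 'rV[int]_d.
Implicit Types u v w f g q : Zd -> R.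

Lemma cvg_nbsum (f : nat -> Zd -> R) u n :
  (forall m, (fun i => f i m) @ \oo --> u m) ->
  (fun i => nbsum (f i) n) @ \oo --> nbsum u n.
Proof.
move=> fu; rewrite /nbsum; elim: (index_enum _) => [|j r ih].
  by rewrite big_nil; under eq_fun do rewrite big_nil; exact: cvg_cst.
rewrite big_cons; under eq_fun do rewrite big_cons.
by apply: cvgD => //; apply: cvgD.
Qed.

(** The limit is taken along tail infima instead of a diagonal subsequence: they increase pointwise,
    the Harnack constants keep them between positive bounds, and monotonicity of [nbsum] makes an
    infimum of supersolutions a supersolution. *)
Lemma positive_supersolution q :
  (forall k, 0 < k -> boundedly_invertible (fun n => q n + k)) ->
  exists u, (forall n, 0 < u n) /\ forall n, 0 <= tq q u n.
Proof.
move=> invq; pose h (i : nat) : R := i.+1%:R^-1.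
have h0 i : 0 < h i by rewrite invr_gt0.
have h1 i : h i <= 1 by rewrite invf_le1// ler1n.
have h_le i j : (i <= j)%N -> h j <= h i by move=> ij; rewrite lef_pV2 ?posrE// ler_nat.
(* As [h i <= 1], this dominates [q + h i] for all [i] at once, which makes the Harnack constants
   independent of [i]. *)
pose Q n : R := `|q n| + 1.
have Q0 n : 0 <= Q n by rewrite addr_ge0.
have /choice[w wP] : forall i, exists w : Zd -> R, [/\ w 0 = 1,
    forall n, 0 <= w n & forall n, nbsum w n <= (q n + h i) * w n].
  move=> i.
  have [surj _] := invq _ (h0 i).
  have [phi [dphi phiE]] := surj _ (@l2r_dirac R d 0).
  have phi0 : forall n, 0 <= phi n.
    apply: (resolvent_ge0 (form_ge0 invq) (h0 i) (dq_unshift dphi)).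
    by move=> n; rewrite phiE ler0n.
  have phiS n : nbsum phi n <= (q n + h i) * phi n.
    have : 0 <= tq (fun n => q n + h i) phi n by rewrite phiE ler0n.
    by rewrite /tq subr_ge0.
  (* If [phi 0 = 0], Harnack forces [phi = 0], contradicting [tq phi = 1] at the origin. *)
  have phi00 : 0 < phi 0.
    rewrite lt_neqAle phi0 andbT; apply/eqP => p0.
    have pz n : phi n = 0.
      have [C C0 /(_ phi phi0)[n'|+ _]] := @harnack R d Q Q0 n.
        apply: le_trans (phiS n') _; rewrite ler_wpM2r//.
        by rewrite lerD ?ler_norm.
      by rewrite -p0 mulr0 => le; apply/eqP; rewrite eq_le le phi0.
    have := congr1 (fun f => f 0) phiE.
    rewrite /tq /nbsum big1 ?pz ?mulr0 ?subr0 /dirac_fun ?eqxx => [/eqP|j _].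
      by rewrite eq_sym oner_eq0.
    by rewrite !pz addr0.
  exists (fun n => (phi 0)^-1 * phi n); split=> [|n|n].
  - by rewrite mulVf ?gt_eqF.
  - by rewrite mulr_ge0 ?invr_ge0.
  - rewrite mulrCA; apply: le_trans (_ : (phi 0)^-1 * nbsum phi n <= _); last first.
      by rewrite ler_wpM2l ?invr_ge0.
    rewrite /nbsum mulr_sumr; apply: ler_sum => j _.
    by rewrite mulrDr.
have Cw n : exists2 C, 0 < C & forall i, C^-1 <= w i n <= C.
  have [C C0 HC] := @harnack R d Q Q0 n; exists C => // i.
  have [w0 wp wS] := wP i.
  have [|] := HC _ wp.
    move=> n'; apply: le_trans (wS n') _; rewrite ler_wpM2r//.
    by rewrite lerD ?ler_norm.
  by rewrite w0 mulr1 => -> le; rewrite andbT -[leLHS]mulr1 ler_pdivrMl.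
pose A i n := [set w j n | j in [set j | (i <= j)%N]].
pose s i n := inf (A i n).
have infA i n : has_inf (A i n).
  split; first by exists (w i n), i => //=.
  have [C C0 HC] := Cw n; exists C^-1 => _ [j _ <-].
  by have /andP[] := HC j.
have s_le i j n : (i <= j)%N -> s i n <= w j n.
  by move=> ij; apply: ge_inf; [exact: (infA i n).2|exists j].
have le_s i n x : (forall j, (i <= j)%N -> x <= w j n) -> x <= s i n.
  by move=> xw; apply: lb_le_inf; [exact: (infA i n).1|move=> _ [j ij <-]; exact: xw].
have s_nd n : nondecreasing_seq (s ^~ n).
  by move=> i j ij; apply: le_s => k jk; apply: s_le; exact: leq_trans jk.
have s_cvg n : cvgn (s ^~ n).
  apply: nondecreasing_is_cvgn; first exact: s_nd.
  have [C C0 HC] := Cw n; exists C => _ [i _ <-].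
  by have /andP[_] := HC i; apply: le_trans; exact: s_le.
pose u n := limn (s ^~ n).
have su n : (s ^~ n) @ \oo --> u n by exact: s_cvg.
have s_pos i n : 0 < s i n.
  have [C C0 HC] := Cw n; apply: lt_le_trans (_ : C^-1 <= _); first by rewrite invr_gt0.
  by apply: le_s => j _; have /andP[] := HC j.
exists u; split=> n.
  apply: lt_le_trans (s_pos 0%N n) _.
  by apply: nondecreasing_cvgn_le; [exact: s_nd|exact: s_cvg].
rewrite /tq subr_ge0.
have hc : h @ \oo --> (0 : R) by exact: cvg_harmonic.
have := ler_cvg_to (@cvg_nbsum s u n su)
  (cvgM (cvgD (cvg_cst (q n)) hc) (su n)).
rewrite addr0; apply; near=> i; rewrite -[leRHS]/((q n + h i) * s i n).
have step j : (i <= j)%N -> nbsum (s i) n <= (q n + h i) * w j n.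
  move=> ij; have [_ wp wS] := wP j.
  apply: le_trans (_ : nbsum (w j) n <= _); first by apply: le_nbsum => m; exact: s_le.
  apply: le_trans (wS n) _; rewrite ler_wpM2r// lerD2l; exact: h_le.
have nb0 : 0 <= nbsum (s i) n.
  by apply: sumr_ge0 => j _; rewrite addr_ge0// ltW.
have wpos : 0 < w i n by apply: lt_le_trans (s_pos i n) _; exact: s_le.
(* The inequality passes to the infimum over [j] after division by [q n + h i], whose sign must be
   known; [step i] gives it, since [nbsum (s i) n >= 0] and [w i n > 0]. *)
have : 0 <= q n + h i.
  have st := le_trans nb0 (step _ (leqnn i)). by move: st; rewrite pmulr_lge0.
rewrite le_eqVlt => /predU1P[c0|c0].
  by have := step i (leqnn _); rewrite -c0 !mul0r.
by rewrite -ler_pdivrMl//; apply: le_s => j ij; rewrite ler_pdivrMl// step.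
Unshelve. all: by end_near. Qed.

(* A point mass absorbs half of the excess [tq q v n0] of a strict supersolution. *)
Lemma subcritical_of_strict_supersolution q v n0 :
  (forall k, 0 < k -> boundedly_invertible (fun n => q n + k)) ->
  (forall n, 0 < v n) -> (forall n, 0 <= tq q v n) -> 0 < tq q v n0 ->
  exists2 a, 0 < a & forall k, 0 < k ->
    boundedly_invertible (fun n => q n - a * dirac_fun n0 n + k).
Proof.
move=> invq v0 Tv0 b0; set b := tq q v n0 in b0.
(* Comparison with [b^-1 * v] yields [g n0 <= v n0 / b] for every [k]. This choice then gives
   [a * g n0 <= 1 / 2], so the determinant stays positive uniformly in [k]. *)
exists (b / (2 * v n0)); first by rewrite divr_gt0// mulr_gt0.
move=> k k0; set a := b / _.
have [g [dg gE]] := (invq k k0).1 _ (@l2r_dirac R d n0).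
have gle : g n0 <= b^-1 * v n0.
  have -> : b^-1 * v n0 = lin b^-1 v 0 v n0 by rewrite /lin; ring.
  apply: (comparison (form_ge0 invq) k0 (dq_unshift dg)) => [n|n _].
    by rewrite /lin mul0r addr0 mulr_ge0 ?invr_ge0 ?ltW.
  rewrite gE tq_lin tq_shift /lin mul0r addr0 mul1r mulrDr.
  have kv : 0 <= b^-1 * (k * v n) by rewrite !mulr_ge0 ?invr_ge0 ?ltW.
  rewrite /dirac_fun; case: eqVneq kv => [->|_] kv.
    by rewrite -/b mulVf ?gt_eqF// lerDl.
  by rewrite addr_ge0// mulr_ge0 ?invr_ge0// ltW.
rewrite (_ : (fun n => _) = fun n => (q n + k) - a * dirac_fun n0 n); last first.
  by apply/funext => n; ring.
apply: invertible_rank_one dg gE _; first exact: invq.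
rewrite gt_eqF// subr_gt0.
apply: (@le_lt_trans _ _ (a * (b^-1 * v n0))).
  by rewrite ler_wpM2l// divr_ge0 ?mulr_ge0 ?ltW.
rewrite (_ : a * _ = 2^-1); last first.
  by rewrite /a; field; rewrite !gt_eqF.
by rewrite invf_lt1// ltr1n.
Qed.

(** Here the determinant is [1 + a * g n0 >= 1]. The lemma is used to see that adding a point mass
    to the potential cannot lower the supremum of the spectrum. *)
Lemma invertible_add_dirac q a n0 : 0 <= a ->
  (forall k, 0 < k -> boundedly_invertible (fun n => q n - a * dirac_fun n0 n + k)) ->
  forall k, 0 < k -> boundedly_invertible (fun n => q n + k).
Proof.
move=> a0 invq k k0.
have [g [dg gE]] := (invq k k0).1 _ (@l2r_dirac R d n0).
have g0 : 0 <= g n0.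
  apply: (resolvent_ge0 (form_ge0 invq) k0 (dq_unshift dg)) => n.
  by rewrite gE ler0n.
rewrite (_ : (fun n => _) =
  fun n => (q n - a * dirac_fun n0 n + k) - (- a) * dirac_fun n0 n); last first.
  by apply/funext => n; ring.
apply: invertible_rank_one dg gE _; first exact: invq.
by rewrite gt_eqF// mulNr opprK ltr_pwDl// mulr_ge0.
Qed.

End Supersolutions.

(** * Gluing *)

Section Gluing.
Context {R : realType} {d : nat}.
Local Notation Zd := 'rV[int]_d.
Implicit Types u v w f g q : Zd -> R.

Lemma l2r_finite f (A : set Zd) : finite_set A -> (forall n, ~ A n -> f n = 0) ->
  l2r f.
Proof.
move=> /finite_seqP[s ->] f0.
have sP (t : seq Zd) : l2r (fun n => if n \in t then f n else 0).
  elim: t => [|m t ih]; first exact: l2r0.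
  have lm : l2r (fun n => `|if n \in t then f n else 0|).
    by apply: l2r_le ih => n; rewrite normr_id.
  apply: l2r_le (l2rD (l2rZ `|f m| (l2r_dirac m)) lm) => n.
  rewrite [leRHS]ger0_norm ?addr_ge0 ?mulr_ge0// ?ler0n//.
  rewrite in_cons /dirac_fun; case: eqVneq => [->|_] /=; last by rewrite mulr0 add0r.
  by rewrite mulr1 lerDl.
apply: l2r_le (sP s) => n; case: ifPn => // /negP ns.
by rewrite f0 ?normr0.
Qed.

Lemma finite_domination u g (A : set Zd) : finite_set A ->
  (forall n, A n -> 0 < g n) -> exists2 C, 0 < C & forall n, A n -> u n <= C * g n.
Proof.
move=> /finite_seqP[s ->]; elim: s => [|m s ih] g0; first by exists 1.
have [n /= ns|C C0 CP] := ih; first by apply: g0; rewrite /= in_cons ns orbT.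
have gm : 0 < g m by apply: g0; rewrite /= in_cons eqxx.
exists (C + `|u m| / g m); first by rewrite ltr_wpDr// divr_ge0// ltW.
move=> n /=; rewrite in_cons => /predU1P[->|ns].
  rewrite mulrDl divfK ?gt_eqF//; apply: le_trans (ler_norm _) _.
  by rewrite lerDr mulr_ge0// ltW.
apply: le_trans (CP _ ns) _; rewrite ler_wpM2r//; last first.
  by rewrite lerDl divr_ge0// ltW.
by apply: ltW; apply: g0; rewrite /= in_cons ns orbT.
Qed.

(** [E] is the region where [g] is positive, and [E'] the one where it is a supersolution;
    neighbours of [E'] stay in [E]. Enlarging [C] until [u <= C g] on the finite collar between them
    gives [v <= C g] on all of [E], besides [v <= u] everywhere. So whichever of [u] and [C g]
    realises [v n], its supersolution inequality passes to [v]. *)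
Lemma l2_solution q g (E E' : set Zd) :
  (exists u, (forall n, 0 < u n) /\ forall n, 0 <= tq q u n) ->
  (forall v, (forall n, 0 < v n) -> (forall n, 0 <= tq q v n) ->
     forall n, tq q v n = 0) ->
  E' `<=` E -> finite_set (~` E') ->
  (forall n j, E' n -> E (n + basisv j) /\ E (n - basisv j)) ->
  (forall n, E n -> 0 < g n) -> (forall n, E' n -> nbsum g n <= q n * g n) ->
  l2r (fun n => if n \in E then g n else 0) ->
  exists v, [/\ forall n, 0 < v n, l2r v & forall n, tq q v n = 0].
Proof.
move=> [u [u0 Tu0]] crit E'E finE' nbE g0 gS gl2.
have [||C C0 CP] := @finite_domination u g (E `&` ~` E').
- exact: finite_setIr.
- by move=> n [/g0].
pose v n := if n \in E' then Num.min (u n) (C * g n) else u n.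
have v_le_u n : v n <= u n by rewrite /v; case: ifP => // _; rewrite ge_min lexx.
have v_le_g n : E n -> v n <= C * g n.
  move=> En; rewrite /v; case: ifPn => [_|/negP nE']; first by rewrite ge_min lexx orbT.
  by apply: CP; split=> // /mem_set.
have vpos n : 0 < v n.
  by rewrite /v; case: ifPn => // /set_mem /E'E /g0 gn; rewrite lt_min u0 mulr_gt0.
have vS n : 0 <= tq q v n.
  rewrite /tq subr_ge0.
  have caseu : v n = u n -> nbsum v n <= q n * v n.
    move=> ->; apply: le_trans (le_nbsum n v_le_u) _.
    by have := Tu0 n; rewrite /tq subr_ge0.
  have [nE'|nE'] := boolP (n \in E'); last by apply: caseu; rewrite /v (negbTE nE').
  have [ug|gu] := leP (u n) (C * g n).
    by apply: caseu; rewrite /v nE' min_l.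
  have -> : v n = C * g n by rewrite /v nE' min_r// ltW.
  apply: (@le_trans _ _ (C * nbsum g n)).
    rewrite /nbsum mulr_sumr; apply: ler_sum => j _; rewrite mulrDr.
    by have [? ?] := nbE n j (set_mem nE'); rewrite lerD// v_le_g.
  by rewrite mulrCA ler_wpM2l ?(ltW C0)// gS//; exact: set_mem.
exists v; split=> //; last exact: crit.
have l1 := l2rZ C gl2.
have l2 : l2r (fun n => if n \in E' then 0 else u n).
  apply: (l2r_finite finE') => n /= nE'; case: ifPn => // nn.
  by case: nE' => /mem_set; rewrite (negbTE nn).
apply: l2r_le (l2rD l1 l2) => n; rewrite ger0_norm ?(ltW (vpos n))//.
have [nE'|nE'] := boolP (n \in E').
  have En := E'E _ (set_mem nE').
  by rewrite addr0 mem_set// ger0_norm ?v_le_g// mulr_ge0 ?ltW// g0.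
rewrite /v (negbTE nE') ger0_norm.
  rewrite lerDr mulr_ge0 ?(ltW C0)//; case: ifPn => // /set_mem /g0; exact: ltW.
rewrite addr_ge0 ?(ltW (u0 _))// mulr_ge0 ?(ltW C0)//.
by case: ifPn => // /set_mem /g0; exact: ltW.
Qed.

End Gluing.

(** * The sign flip and the Laplacian *)

Section ComplexBridge.
Context {R : realType} {d : nat}.
Local Notation Zd := 'rV[int]_d.
Implicit Types (u v w f q V : Zd -> R) (psi : Zd -> R[i]).

Definition sgn (n : Zd) : R := (-1) ^ (\sum_j n ord0 j).

Lemma sgn_basisv n j : sgn (n + basisv j) = - sgn n.
Proof.
rewrite /sgn (eq_bigr (fun i => n ord0 i + (i == j)%:Z)); last first.
  by move=> i _; rewrite /basisv !mxE eqxx natz.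
rewrite big_split /= expfzDr ?oppr_eq0 ?oner_eq0//.
suff -> : \sum_i (i == j)%:Z = 1 by rewrite expr1z mulrN1.
by rewrite (bigD1 j)//= eqxx big1 ?addr0// => i /negbTE ->.
Qed.

Lemma sgn_basisvN n j : sgn (n - basisv j) = - sgn n.
Proof. by rewrite -[in RHS](subrK (basisv j) n) sgn_basisv opprK. Qed.

Lemma sgn_sqr n : sgn n * sgn n = 1.
Proof. by rewrite /sgn -expfzMl mulrNN mulr1 exp1rz. Qed.

(** Coordinates with the sign flip built in: every complex function has this form, the norm is
    unaffected, and H_V acts on both components by the same real operator. *)
Definition cplx u w : Zd -> R[i] := fun n => (sgn n * u n) +i* (sgn n * w n).

Lemma cplxP psi : exists u w, psi = cplx u w.
Proof.
exists (fun n => sgn n * complex.Re (psi n)), (fun n => sgn n * complex.Im (psi n)).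
by apply/funext => n; rewrite /cplx !mulrA sgn_sqr !mul1r; case: (psi n).
Qed.

Lemma cplx_inj u w u' w' : cplx u w = cplx u' w' -> u = u' /\ w = w'.
Proof.
have E n x y : sgn n * x = sgn n * y -> x = y.
  by move=> /(congr1 (fun z => sgn n * z)); rewrite !mulrA sgn_sqr !mul1r.
move=> e; split; apply/funext => n; apply: (@E n).
  exact: (congr1 (fun p => complex.Re (p n)) e).
exact: (congr1 (fun p => complex.Im (p n)) e).
Qed.

Lemma normc_cplx u w n : Normc.normc (cplx u w n) ^+ 2 = u n ^+ 2 + w n ^+ 2.
Proof.
rewrite /= sqr_sqrtr ?addr_ge0 ?sqr_ge0// !exprMn.
by rewrite (_ : sgn n ^+ 2 = 1) ?mul1r// expr2 sgn_sqr.
Qed.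

Lemma l2norm_cplx u w :
  l2norm (cplx u w) = sqrte (\esum_(n in [set: Zd]) (u n ^+ 2 + w n ^+ 2)%:E)%E.
Proof. by congr sqrte; apply: eq_esum => n _; congr EFin; exact: normc_cplx. Qed.

Lemma l2_cplx u w : l2 R d (cplx u w) <-> l2r u /\ l2r w.
Proof.
rewrite /l2 /= l2norm_cplx.
have -> : (sqrte (\esum_(n in [set: Zd]) (u n ^+ 2 + w n ^+ 2)%:E) < +oo)%E <->
    summ (fun n => u n ^+ 2 + w n ^+ 2).
  rewrite /summ (@eq_esum _ _ _ (fun n => `|u n ^+ 2 + w n ^+ 2|%:E)
    (fun n => (u n ^+ 2 + w n ^+ 2)%:E)); last first.
    by move=> n _; rewrite ger0_norm// addr_ge0 ?sqr_ge0.
  by case: (esum _ _) => [r||] //=; rewrite ?ltry.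
split=> [s|[lu lw]]; last exact: summD.
by split; apply: summ_le s => n; rewrite ger0_norm ?sqr_ge0// ?lerDl ?lerDr sqr_ge0.
Qed.

Lemma l2norm_cplx_ip u w : l2r u -> l2r w ->
  l2norm (cplx u w) = (Num.sqrt (ip u u + ip w w))%:E.
Proof.
move=> lu lw; rewrite l2norm_cplx -psum_fin; last 2 first.
- by move=> n; rewrite addr_ge0 ?sqr_ge0.
- exact: summD.
rewrite /= psumD//; try by move=> n; rewrite sqr_ge0.
rewrite -!rsumE//; try by move=> n; rewrite sqr_ge0.
Qed.

(** Integer squares summing to 1: exactly one of them is nonzero, and it equals 1. *)
Lemma enorm_eq1 (k : Zd) : enorm R k = 1 ->
  exists j, k = basisv j \/ k = - basisv j.
Proof.
rewrite /enorm => /(congr1 (fun x => x ^+ 2)).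
rewrite sqr_sqrtr ?sumr_ge0// => [|j _]; last exact: sqr_ge0.
rewrite expr1n.
have -> : \sum_(j < d) ((k ord0 j)%:~R : R) ^+ 2 = (\sum_(j < d) k ord0 j ^+ 2)%:~R.
  by rewrite rmorph_sum; apply: eq_bigr => j _; rewrite rmorphXn.
rewrite -[RHS]/(1%:~R) => /intr_inj k1.
have [j kj] : exists j, k ord0 j != 0.
  apply/existsP; apply: contra_eqT k1; rewrite negb_exists => /forallP k0.
  by rewrite big1// => j _; move: (k0 j); rewrite negbK => /eqP ->.
have kj1 : 1 <= k ord0 j ^+ 2 by rewrite -gtz0_ge1 lt_neqAle sqr_ge0 eq_sym sqrf_eq0 kj.
move: k1; rewrite (bigD1 j)//= => k1.
have rest0 : 0 <= \sum_(i < d | i != j) k ord0 i ^+ 2.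
  by apply: sumr_ge0 => i _; exact: sqr_ge0.
have r0 : \sum_(i < d | i != j) k ord0 i ^+ 2 = 0.
  by apply/eqP; rewrite eq_le rest0 andbT -(lerD2l (k ord0 j ^+ 2)) k1 addr0.
have kj2 : k ord0 j ^+ 2 = 1 by rewrite -k1 r0 addr0.
have ki i : i != j -> k ord0 i = 0.
  move=> ij; apply/eqP; rewrite -sqrf_eq0; apply/eqP.
  move/eqP: r0; rewrite psumr_eq0 => [/allP/(_ i)|l _]; last exact: sqr_ge0.
  by rewrite mem_index_enum ij => /(_ isT)/eqP.
exists j; have /eqP := kj2; rewrite sqrf_eq1 => /orP[/eqP e|/eqP e]; [left|right];
  apply/rowP => i; rewrite /basisv !mxE eqxx/=; case: (eqVneq i j) => [->|ij]; rewrite ?e ?ki//.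
Qed.

Lemma enorm_basisv j : enorm R (basisv j : Zd) = 1.
Proof.
rewrite /enorm (bigD1 j)//= big1 => [|i ij].
  by rewrite /basisv !mxE !eqxx expr1n addr0 sqrtr1.
by rewrite /basisv !mxE (negbTE ij) andbF expr0n.
Qed.

Lemma enormN (n : Zd) : enorm R (- n) = enorm R n.
Proof.
by congr Num.sqrt; apply: eq_bigr => j _; rewrite mxE rmorphN sqrrN.
Qed.

Lemma basisv_inj : injective (@basisv d).
Proof.
move=> i j /rowP/(_ i); rewrite /basisv !mxE !eqxx /=.
by case: eqVneq => // ->.
Qed.

Lemma laplacianE psi n : act (laplacian R d) psi n =
  \sum_(j < d) ((psi n - psi (n + basisv j)) + (psi n - psi (n - basisv j))).
Proof.
pose s := [seq n + basisv j | j <- index_enum 'I_d] ++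
          [seq n - basisv j | j <- index_enum 'I_d].
have us : uniq s.
  rewrite cat_uniq !map_inj_uniq ?index_enum_uniq//; last 2 first.
  - by move=> i j /addrI/oppr_inj/basisv_inj.
  - by move=> i j /addrI/basisv_inj.
  rewrite andbT /=; apply/hasPn => _ /mapP[j _ ->]; apply/negP => /mapP[i _].
  move=> /addrI/rowP/(_ i); rewrite /basisv !mxE !eqxx /=.
  by case: eqVneq.
have -> : act (laplacian R d) psi n = \sum_(m \in [set` s]) (psi n - psi m).
  rewrite /=; apply: eq_fsbigl; apply/seteqP; split=> m /=.
    move=> /enorm_eq1[j jm]; rewrite /s mem_cat.
    case: jm => e; apply/orP; [left|right]; apply/mapP; exists j;
      rewrite ?mem_index_enum// -e; by rewrite addrC subrK.
  rewrite /s mem_cat => /orP[] /mapP[j _ ->].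
    by rewrite addrAC subrr add0r enorm_basisv.
  by rewrite addrAC subrr add0r enormN enorm_basisv.
by rewrite -fsbig_seq// /s big_cat !big_map /= -big_split.
Qed.

Lemma sum_complex (a b : 'I_d -> R) :
  \sum_(j < d) (a j +i* b j) = (\sum_(j < d) a j) +i* (\sum_(j < d) b j).
Proof. by elim/big_rec3: _ => // j x y z _ ->. Qed.

Lemma laplacian_cplx u w : act (laplacian R d) (cplx u w) =
  cplx (fun n => 2 * d%:R * u n + nbsum u n) (fun n => 2 * d%:R * w n + nbsum w n).
Proof.
apply/funext => n; rewrite laplacianE.
have E f : sgn n * (2 * d%:R * f n + nbsum f n) =
    \sum_(j < d) ((sgn n * f n - sgn (n + basisv j) * f (n + basisv j)) +
                  (sgn n * f n - sgn (n - basisv j) * f (n - basisv j))).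
  transitivity (\sum_(j < d) (2 * (sgn n * f n) +
      sgn n * (f (n + basisv j) + f (n - basisv j)))).
    rewrite big_split/= sumr_const card_ord -mulr_sumr -/(nbsum f n) -mulr_natl.
    by ring.
  by apply: eq_bigr => j _; rewrite sgn_basisv sgn_basisvN; ring.
by rewrite /cplx !E -sum_complex; apply: eq_bigr => j _.
Qed.

Lemma mult_op_cplx V u w : act (mult_op V) (cplx u w) =
  cplx (fun n => V n * u n) (fun n => V n * w n).
Proof.
apply/funext => n; rewrite /cplx /=; apply/eqP; rewrite eq_complex /=.
by rewrite !mul0r subr0 addr0; apply/andP; split; apply/eqP; ring.
Qed.

Lemma schrodinger_cplx V u w : act (schrodinger V) (cplx u w) =
  cplx (fun n => (2 * d%:R + V n) * u n + nbsum u n)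
       (fun n => (2 * d%:R + V n) * w n + nbsum w n).
Proof.
apply/funext => n.
rewrite -[LHS]/(act (laplacian R d) (cplx u w) n + act (mult_op V) (cplx u w) n).
rewrite laplacian_cplx mult_op_cplx /cplx; apply/eqP; rewrite eq_complex /=.
by apply/andP; split; apply/eqP; ring.
Qed.

Lemma dom_schrodinger_cplx V u w : dom (schrodinger V) (cplx u w) <-> dq V u /\ dq V w.
Proof.
have mE : (fun n => (V n)%:C * cplx u w n) =
  cplx (fun n => V n * u n) (fun n => V n * w n) := mult_op_cplx V u w.
split=> [[/= _ [/l2_cplx[lu lw]]]|[[lu lVu] [lw lVw]]].
  by rewrite mE => /l2_cplx[].
have luw : l2 R d (cplx u w) by exact/l2_cplx.
by split=> //; split=> //=; rewrite mE; exact/l2_cplx.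
Qed.

(** The sign flip turns [s - H_V] into [tq (top_potential V s)]; for [s = 4d] this is the potential
    [2d - V]. *)
Definition top_potential V (s : R) : Zd -> R := fun n => s - 2 * d%:R - V n.

Lemma dq_top_potential V s u : dq V u -> dq (top_potential V s) u.
Proof.
move=> [lu lq]; split=> //; have := l2r_lin (s - 2 * d%:R) (-1) lu lq; congr l2r.
by apply/funext => n; rewrite /lin /top_potential; ring.
Qed.

Lemma dq_of_top_potential V s u : dq (top_potential V s) u -> dq V u.
Proof.
move=> [lu lq]; split=> //; have := l2r_lin (s - 2 * d%:R) (-1) lu lq; congr l2r.
by apply/funext => n; rewrite /lin /top_potential; ring.
Qed.

Lemma op_shift_cplx V s u w : op_shift (schrodinger V) s%:C (cplx u w) =
  cplx (fun n => - tq (top_potential V s) u n) (fun n => - tq (top_potential V s) w n).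
Proof.
apply/funext => n; rewrite /op_shift schrodinger_cplx /cplx /tq /top_potential.
apply/eqP; rewrite eq_complex /=.
by apply/andP; split; apply/eqP; ring.
Qed.

End ComplexBridge.

(** * Spectrum and criticality in terms of [tq] *)

Section SpectralBridge.
Context {R : realType} {d : nat}.
Local Notation Zd := 'rV[int]_d.
Implicit Types (u v w f q V : Zd -> R) (psi : Zd -> R[i]).

Lemma l2rN u : l2r u -> l2r (fun n => - u n).
Proof. by move=> lu; have := l2rZ (-1) lu; under eq_fun do rewrite mulN1r. Qed.

Lemma ipNN u : ip (fun n => - u n) (fun n => - u n) = ip u u.
Proof. by congr rsum; apply/funext => n; rewrite mulrNN. Qed.

Lemma dq0 q : dq q (fun=> 0 : R).
Proof. by split; [exact: l2r0|under eq_fun do rewrite mulr0; exact: l2r0]. Qed.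

Lemma tq0 q : tq q (fun=> 0) = fun=> 0.
Proof.
by apply/funext => n; rewrite /tq /nbsum mulr0 big1 ?subr0// => j _; rewrite addr0.
Qed.

Lemma ip00 : ip (fun _ : Zd => 0 : R) (fun=> 0) = 0.
Proof. by rewrite /ip; under eq_fun do rewrite mulr0; exact: rsum0. Qed.

Lemma invertible_of_resolvent V s : resolvent_set (schrodinger V) s%:C ->
  boundedly_invertible (top_potential V s).
Proof.
move=> [B [[M bdB] solB invB]]; split=> [f lf|].
  pose phi := cplx (fun n => - f n) (fun=> 0).
  have lphi : l2 R d phi by apply/l2_cplx; split; [exact: l2rN|exact: l2r0].
  have [] := solB _ lphi; have [u [w ->]] := cplxP (B phi).
  move=> /dom_schrodinger_cplx[du _].
  rewrite op_shift_cplx => /cplx_inj[fE _].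
  exists u; split; first exact: dq_top_potential du.
  apply/funext => n; have := congr1 (fun g => - g n) fE.
  by rewrite /= !opprK.
exists (M ^+ 2); first exact: sqr_ge0.
move=> u du; have dc : dom (schrodinger V) (cplx u (fun=> 0)).
  by apply/dom_schrodinger_cplx; split; [exact: dq_of_top_potential du|exact: dq0].
have lT := l2r_tq du; have lu : l2r u by case: du.
have l2T : l2 R d (op_shift (schrodinger V) s%:C (cplx u (fun=> 0))).
  rewrite op_shift_cplx; apply/l2_cplx; rewrite tq0; split; [exact: (l2rN lT)|exact: (l2rN l2r0)].
have := bdB _ l2T; rewrite invB// op_shift_cplx tq0.
rewrite !l2norm_cplx_ip//; [|exact: (l2rN lT)|exact: (l2rN l2r0)|exact: l2r0].
rewrite !ipNN ip00 !addr0 -EFinM lee_fin => le.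
(* [M] may be negative; the right-hand side is nonnegative because it dominates a square root. *)
have := le; rewrite -(ler_pXn2r (n := 2))// ?nnegrE ?sqrtr_ge0//; last first.
  exact: le_trans (sqrtr_ge0 _) le.
by rewrite exprMn !sqr_sqrtr// ip_ge0.
Qed.

Lemma invertible_inj q u v : boundedly_invertible q -> dq q u -> dq q v ->
  tq q u = tq q v -> u = v.
Proof.
move=> [_ [M M0 bd]] du dv uv.
have dw := dq_lin 1 (-1) du dv.
have lw : l2r (lin 1 u (-1) v) by case: dw.
have w0 : forall n, lin 1 u (-1) v n = 0.
  apply: (ip_eq0 lw); apply: le_trans (bd _ dw) _.
  rewrite tq_lin uv (_ : lin _ _ _ _ = fun=> 0) ?ip00 ?mulr0//.
  by apply/funext => n; rewrite /lin; ring.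
by apply/funext => n; have := w0 n; rewrite /lin; lra.
Qed.

Lemma resolvent_of_invertible V s : boundedly_invertible (top_potential V s) ->
  resolvent_set (schrodinger V) s%:C.
Proof.
move=> inv; have [surj [M M0 bd]] := inv.
(* A total solution map; its values outside l^2 are arbitrary. *)
have /choice[S SP] : forall f : Zd -> R, exists u, l2r f ->
    dq (top_potential V s) u /\ tq (top_potential V s) u = f.
  move=> f; have [lf|nlf] := pselect (l2r f); last by exists f.
  by have [u uP] := surj _ lf; exists u.
(* The resolvent acts on each coordinate by [S]; the minus signs reflect that [op_shift] is
   [- tq]. *)
have /choice[B BP] : forall phi, exists psi, forall f g : Zd -> R,
    phi = cplx (fun n => - f n) (fun n => - g n) -> psi = cplx (S f) (S g).
  move=> phi; have [f [g ->]] := cplxP phi.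
  exists (cplx (S (fun n => - f n)) (S (fun n => - g n))) => f' g' /cplx_inj[-> ->].
  by congr (cplx (S _) (S _)); apply/funext => n; rewrite opprK.
have phiE phi : l2 R d phi -> exists f g : Zd -> R,
    [/\ phi = cplx (fun n => - f n) (fun n => - g n), l2r f & l2r g].
  have [f [g ->]] := cplxP phi => /l2_cplx[lf lg].
  exists (fun n => - f n), (fun n => - g n); split; [|exact: l2rN..].
  by congr cplx; apply/funext => n; rewrite opprK.
exists B; split.
- exists (Num.sqrt M) => phi /phiE[f [g [e lf lg]]].
  rewrite (BP _ _ _ e) e; have [df fE] := SP _ lf; have [dg gE] := SP _ lg.
  have [lSf _] := df; have [lSg _] := dg.
  rewrite !l2norm_cplx_ip//; try exact: l2rN.
  rewrite -EFinM lee_fin -sqrtrM// !ipNN ler_sqrt; last first.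
    by rewrite mulr_ge0// addr_ge0// ip_ge0.
  by have := bd _ df; have := bd _ dg; rewrite fE gE; lra.
- move=> phi /phiE[f [g [e lf lg]]].
  rewrite (BP _ _ _ e) e; have [df fE] := SP _ lf; have [dg gE] := SP _ lg.
  split.
    apply/dom_schrodinger_cplx; split; first exact: dq_of_top_potential df.
    exact: dq_of_top_potential dg.
  by rewrite op_shift_cplx fE gE.
- move=> psi; have [u [w ->]] := cplxP psi => /dom_schrodinger_cplx[du dw].
  rewrite (BP _ _ _ (op_shift_cplx V s u w)).
  have du' := dq_top_potential s du; have dw' := dq_top_potential s dw.
  have [? ?] := SP _ (l2r_tq du'); have [? ?] := SP _ (l2r_tq dw').
  by congr cplx; apply: (invertible_inj inv).
Qed.

(** Raising the energy from [s] to [s + k] adds [k] to [top_potential], so an upper bound on the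
    spectrum becomes invertibility under all positive shifts. *)
Lemma sup_spectrum_le V s : (sup_real (spectrum (schrodinger V)) <= s%:E)%E <->
  forall k, 0 < k -> boundedly_invertible (fun n => top_potential V s n + k).
Proof.
have E k : (fun n => top_potential V s n + k) = top_potential V (s + k).
  by apply/funext => n; rewrite /top_potential; ring.
split=> [le k k0|inv].
  rewrite E; apply: invertible_of_resolvent; apply: contrapT => nr.
  have : ((s + k)%:E <= s%:E)%E.
    by apply: le_trans le; apply: ereal_sup_ubound; exists (s + k).
  by rewrite lee_fin; lra.
apply: ge_ereal_sup => _ [x /= xs <-]; rewrite lee_fin leNgt; apply/negP => sx.
apply: xs; apply: resolvent_of_invertible.
by have := inv (x - s); rewrite subr_gt0 sx E subrKC => /(_ isT).
Qed.

(** A point mass is a bounded multiplier, hence does not change the maximal domain; the perturbed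
    operator is again of Schrödinger type. *)
Lemma op_add_mult_dirac V a n0 :
  op_add (schrodinger V) (mult_op (fun n => a * dirac_fun n0 n)) =
  schrodinger (fun n => V n + a * dirac_fun n0 n).
Proof.
have lW u : l2r u -> l2r (fun n => a * dirac_fun n0 n * u n).
  move=> lu; have := l2rZ (a * u n0) (l2r_dirac n0); congr l2r.
  by apply/funext => n; rewrite /dirac_fun; case: eqVneq => [->|_] /=; ring.
congr Operator; last first.
  apply/funext => psi; apply/funext => n /=.
  by rewrite -addrA -mulrDl -rmorphD.
apply/seteqP; split=> psi; have [u [w ->]] := cplxP psi.
  move=> [/dom_schrodinger_cplx[[lu lVu] [lw lVw]] _]; apply/dom_schrodinger_cplx.
  split; split=> //; under eq_fun do rewrite mulrDl; apply: l2rD => //; exact: lW.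
move=> /dom_schrodinger_cplx[[lu lVu] [lw lVw]]; split.
  have sub x : l2r x -> l2r (fun n => (V n + a * dirac_fun n0 n) * x n) ->
      l2r (fun n => V n * x n).
    move=> /lW lx lVx; have := l2r_lin 1 (-1) lVx lx; congr l2r.
    by apply/funext => n; rewrite /lin; ring.
  by apply/dom_schrodinger_cplx; split; split=> //; apply: sub.
split; first exact/l2_cplx.
have := mult_op_cplx (fun n => a * dirac_fun n0 n) u w; rewrite /= => ->.
by apply/l2_cplx; split; exact: lW.
Qed.

Lemma normr_le_l2norm_cplx u w (M : R) n : (l2norm (cplx u w) <= M%:E)%E ->
  `|u n| <= M /\ `|w n| <= M.
Proof.
move=> le.
have [lu lw] : l2r u /\ l2r w by apply/l2_cplx; exact: le_lt_trans le (ltry _).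
move: le; rewrite l2norm_cplx_ip// lee_fin => le.
have one (x : Zd -> R) : l2r x -> x n ^+ 2 <= ip x x.
  move=> lx; rewrite expr2; apply: (@ge_rsum1 _ _ (fun n => x n * x n)).
    by move=> m; rewrite -expr2 sqr_ge0.
  exact: l2r_mul.
have gu := ip_ge0 lu; have gw := ip_ge0 lw.
have ou := one _ lu; have ow := one _ lw.
have S0 : 0 <= ip u u + ip w w by exact: addr_ge0.
by split; apply: le_trans le; rewrite -sqrtr_sqr ler_sqrt// ?(le_trans ou) ?(le_trans ow)//
  ?lerDl ?lerDr.
Qed.

Lemma ip_scale_dirac (c : R) (n0 : Zd) :
  ip (fun n => c * dirac_fun n0 n) (fun n => c * dirac_fun n0 n) = c ^+ 2.
Proof.
pose D := dirac_fun n0 : Zd -> R.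
have D0 n : 0 <= D n by exact: ler0n.
have sD : summ D.
  have : summ (fun n => D n ^+ 2) := l2r_dirac n0; congr summ; apply/funext => n.
  by rewrite /D /dirac_fun; case: eqVneq; rewrite ?expr1n ?expr0n.
rewrite /ip (_ : (fun n => _) = fun n => c ^+ 2 * D n); last first.
  by apply/funext => n; rewrite /D /dirac_fun; case: eqVneq => _ /=; ring.
rewrite rsumZ// rsumE// (_ : psum D = 1) ?mulr1// /psum.
rewrite (eq_esum (b := fun n => if n \in [set n0] then 1%:E else 0%E)).
  by rewrite -esum_mkcondr setTI esum_set1// lee_fin.
move=> n _; rewrite /D /dirac_fun; case: eqVneq => [->|nn0].
  by rewrite mem_set.
by rewrite memNset//=; exact/eqP.
Qed.

(** The image is determined by the value at [n0], so Bolzano-Weierstrass suffices, applied to one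
    real coordinate and then, along that subsequence, to the other. *)
Lemma compact_mult_dirac (a : R) (n0 : Zd) :
  compact_op (mult_op (fun n => a * dirac_fun n0 n)).
Proof.
set W := fun n => _.
have WE (u w : Zd -> R) : (fun n => (W n)%:C * cplx u w n) =
    cplx (fun n => (a * u n0) * dirac_fun n0 n) (fun n => (a * w n0) * dirac_fun n0 n).
  have := mult_op_cplx W u w; rewrite /= => ->.
  by congr cplx; apply/funext => n; rewrite /W /dirac_fun; case: eqVneq => [->|_] /=; ring.
split=> [psi|psi [M psiM]].
  have [u [w ->]] := cplxP psi => luw; split=> //=; rewrite WE.
  by apply/l2_cplx; split; apply: l2rZ; exact: l2r_dirac.
have /choice[u uP] : forall k, exists u, exists w, psi k = cplx u w.
  by move=> k; exact: cplxP.
have /choice[w uwP] := uP.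
have bnd k : `|u k n0| <= M /\ `|w k n0| <= M.
  by apply: normr_le_l2norm_cplx; rewrite -uwP; exact: psiM.
have bdd (x : nat -> R) : (forall k, `|x k| <= M) -> bounded_fun x.
  move=> xM; exists M; split; first exact: num_real.
  by move=> y My k _ /=; apply: le_trans (xM k) (ltW My).
have [p1 inc1 cvg1] := bolzano_weierstrass (bdd (fun k => u k n0) (fun k => (bnd k).1)).
have [p2 inc2 cvg2] := bolzano_weierstrass
  (bdd (fun k => w (p1 k) n0) (fun k => (bnd (p1 k)).2)).
have hom (p : nat -> nat) : increasing_seq p -> {homo p : i j / (i < j)%N}.
  by move=> inc i j ij; have := inc j i; rewrite leEnat ltnNge => ->; rewrite -ltnNge.
exists (p1 \o p2); first by move=> i j ij /=; apply/(hom _ inc1)/(hom _ inc2).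
have sub (x : nat -> R) : cvgn x -> (x \o p2) @ \oo --> limn x.
  move=> cx; apply: cvg_comp cx; move=> A [N _ NA]; exists N => // k /= Nk.
  apply: NA => /=; apply: leq_trans Nk _; elim: k => // k ih.
  by apply: leq_ltn_trans ih _; exact: (hom _ inc2).
have {cvg1} := sub _ cvg1; set lu := limn _ => cu.
have {cvg2} := cvg2 : _ @ \oo --> _; set lw := limn _ => cw.
exists (cplx (fun n => (a * lu) * dirac_fun n0 n) (fun n => (a * lw) * dirac_fun n0 n)).
  by apply/l2_cplx; split; apply: l2rZ; exact: l2r_dirac.
rewrite (_ : (fun k => _) = fun k => (Num.sqrt ((a * (u (p1 (p2 k)) n0 - lu)) ^+ 2 +
    (a * (w (p1 (p2 k)) n0 - lw)) ^+ 2))%:E); last first.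
  apply/funext => k; rewrite -[LHS]/(l2norm (fun n => (W n)%:C * psi (p1 (p2 k)) n - _)).
  rewrite -!(ip_scale_dirac _ n0) -l2norm_cplx_ip; try by apply: l2rZ; exact: l2r_dirac.
  congr l2norm; apply/funext => n; rewrite uwP.
  rewrite [X in X - _](congr1 (fun h => h n) (WE (u (p1 (p2 k))) (w (p1 (p2 k))))).
  apply/eqP; rewrite eq_complex /=.
  by apply/andP; split; apply/eqP; ring.
apply: cvg_EFin; first by near=> k.
have Z (x : nat -> R) l : x @ \oo --> l -> (fun k => (a * (x k - l)) ^+ 2) @ \oo --> (0 : R).
  move=> xl; have H : (fun k => a * (x k - l)) @ \oo --> a * (l - l).
    by apply: cvgM; [exact: cvg_cst|apply: cvgB => //; exact: cvg_cst].
  have HH := cvgM H H; rewrite subrr !mulr0 in HH.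
  rewrite (_ : (fun k => _) = (fun k => a * (x k - l)) \* (fun k => a * (x k - l)))//.
  exact: HH.
have H := cvg_comp _ _ (cvgD (Z _ _ cu) (Z _ _ cw)) (@sqrt_continuous R (0 + 0)).
rewrite addr0 sqrtr0 in H.
exact: (H _).
Unshelve. all: by end_near. Qed.

Lemma critical_solution V s :
  critical_from_above V s ->
  forall v, (forall n, 0 < v n) -> (forall n, 0 <= tq (top_potential V s) v n) ->
  forall n, tq (top_potential V s) v n = 0.
Proof.
move=> [hsup hcrit] v v0 Tv n0; apply/eqP; rewrite eq_le Tv andbT leNgt; apply/negP => b0.
have le : (sup_real (spectrum (schrodinger V)) <= s%:E)%E by rewrite hsup.
have inv := (sup_spectrum_le V s).1 le.
have [a a0 inva] := subcritical_of_strict_supersolution inv v0 Tv b0.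
pose W n := a * dirac_fun n0 n.
have W0 : forall n, 0 <= W n by move=> n; rewrite mulr_ge0// ?ler0n// ltW.
have qE t : top_potential (fun n => V n + W n) t =
    fun n => top_potential V t n - a * dirac_fun n0 n.
  by apply/funext => n; rewrite /top_potential /W; ring.
have : W n0 = 0.
  apply: (hcrit W W0); first exact: compact_mult_dirac.
  rewrite op_add_mult_dirac.
  set S := sup_real _; have Sle : (S <= s%:E)%E.
    by apply/sup_spectrum_le; rewrite qE.
  (* Criticality needs equality of suprema. Were the new one at most some [t < s], removing the
     point mass would put sup sigma(H_V) below [s] as well. *)
  apply/eqP; rewrite eq_le Sle /= leNgt; apply/negP => Slt.
  have [t tS ts] : exists2 t : R, (S <= t%:E)%E & t < s.
    move: Slt; case: S {Sle} => [r||]//; rewrite ?lte_fin => rs.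
      by exists r.
    by exists (s - 1); [rewrite leNye|lra].
  have := (sup_spectrum_le _ t).1 tS; rewrite qE => invt.
  have := invertible_add_dirac (ltW a0) invt => /sup_spectrum_le.
  by rewrite hsup lee_fin leNgt ts.
by rewrite /W /dirac_fun eqxx mulr1 => a00; move: a0; rewrite a00 ltxx.
Qed.

Lemma eigenvalue_of_solution V s v :
  (exists n, v n != 0) -> l2r v -> (forall n, tq (top_potential V s) v n = 0) ->
  point_spectrum (schrodinger V) s%:C.
Proof.
move=> [n0 v0] lv Tv; have dv : dq (top_potential V s) v.
  (* The equation itself supplies the domain condition: the product of the potential with [v] equals
     [nbsum v]. *)
  split=> //; rewrite (_ : (fun n => _) = nbsum v); first exact: l2r_nbsum.
  by apply/funext => n; apply/eqP; rewrite -subr_eq0; apply/eqP; exact: Tv.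
exists (cplx v (fun=> 0)).
  split.
    by apply/dom_schrodinger_cplx; split; [exact: dq_of_top_potential dv|exact: dq0].
  apply/funext => n; apply/eqP; rewrite -subr_eq0.
  rewrite -[X in X == 0]/(op_shift (schrodinger V) s%:C (cplx v (fun=> 0)) n).
  rewrite op_shift_cplx tq0 /cplx Tv; apply/eqP.
  by rewrite oppr0 mulr0.
move=> /(congr1 (fun psi => complex.Re (psi n0))) /= /(congr1 (fun x => sgn n0 * x)).
by rewrite mulrA sgn_sqr mul1r mulr0 => /eqP; rewrite (negbTE v0).
Qed.

End SpectralBridge.

(** * Iterated logarithms and lattice shells *)

Section IteratedLogarithms.
Context {R : realType}.
Implicit Types x y : R.

Lemma ilogS k x : ilog k.+1 x = ln (ilog k x).
Proof. by []. Qed.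

Lemma ilog_large (s : nat) (K : R) :
  exists X : R, forall x, X <= x -> forall k, (k <= s)%N -> K <= ilog k x.
Proof.
elim: s => [|s [X XP]]; first by exists K => x Kx k; rewrite leqn0 => /eqP ->.
exists (Num.max K (expR X)) => x; rewrite ge_max => /andP[Kx Xx] [|k] ks //.
have x0 : 0 < x := lt_le_trans (expR_gt0 X) Xx.
rewrite /ilog iterSr; apply: XP => //.
by rewrite -(expRK X) ler_ln ?posrE ?expR_gt0.
Qed.

Lemma ler_ilog (s : nat) x y : (forall k, (k <= s)%N -> 0 < ilog k x) -> x <= y ->
  forall k, (k <= s.+1)%N -> ilog k x <= ilog k y.
Proof.
move=> x0 xy; elim=> [//|k ih] ks; have le := ih (ltnW ks).
by rewrite !ilogS ler_ln ?posrE ?x0// (lt_le_trans (x0 _ ks)).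
Qed.

(** Iteration of [ln y - ln x >= (y - x) / y]; the product is the derivative of [ilog k] at the
    right endpoint. *)
Lemma ilogB_ge (s : nat) x y : (forall k, (k <= s)%N -> 0 < ilog k x) -> x <= y ->
  forall k, (k <= s.+1)%N ->
  (y - x) * \prod_(0 <= i < k) (ilog i y)^-1 <= ilog k y - ilog k x.
Proof.
move=> x0 xy; elim=> [|k ih] ks; first by rewrite big_nil mulr1.
have kx := x0 k ks; have ky := lt_le_trans kx (ler_ilog x0 xy (ltnW ks)).
rewrite big_nat_recr// mulrA.
apply: (@le_trans _ _ ((ilog k y - ilog k x) / ilog k y)).
  by rewrite ler_wpM2r ?invr_ge0 ?(ltW ky)//; exact: ih (ltnW ks).
rewrite !ilogS -[leRHS]opprB -ln_div ?posrE//.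
have := expR_ge1Dx (ln (ilog k x / ilog k y)).
by rewrite lnK ?posrE ?divr_gt0// mulrBl divff ?gt_eqF//; lra.
Qed.

(** Minus the logarithm of the comparison function at radius [x], when [a = d / 2]: powers of
    iterated logarithms become a linear combination of the next ones. *)
Definition log_weight (a : R) (s : nat) (eps x : R) : R :=
  a * ilog 1 x + 2^-1 * (\sum_(1 <= i < s.+1) ilog i.+1 x) + eps * ilog s.+1 x.

Lemma ler_log_weight a s eps x y : 0 <= a -> 0 <= eps ->
  (forall k, (k <= s)%N -> 0 < ilog k x) -> x <= y ->
  log_weight a s eps x <= log_weight a s eps y.
Proof.
move=> a0 e0 x0 xy; have le := ler_ilog x0 xy.
rewrite /log_weight !lerD// ler_wpM2l ?invr_ge0 ?le//.
by rewrite !big_nat; apply: ler_sum => i /andP[i1 si]; exact: le.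
Qed.

(** The factor [x ^+ d] is the volume growth; the exponent [d / 2] of the weight, doubled by
    squaring, cancels it exactly. *)
Lemma expR_log_weight (d s : nat) eps x : (forall k, (k <= s)%N -> 0 < ilog k x) ->
  expR (- (2 * log_weight (d%:R / 2) s eps x)) * x ^+ d =
  expR (- (2 * eps * ilog s.+1 x)) * \prod_(1 <= i < s.+1) (ilog i x)^-1.
Proof.
move=> x0; have xp : 0 < x by exact: (x0 0%N).
have -> : x ^+ d = expR (d%:R * ilog 1 x).
  by rewrite expRM_natl /ilog /= lnK ?posrE.
have -> : \prod_(1 <= i < s.+1) (ilog i x)^-1 = expR (- \sum_(1 <= i < s.+1) ilog i.+1 x).
  rewrite -sumrN expR_sum !big_nat; apply: eq_bigr => i /andP[i1 si].
  by rewrite expRN ilogS lnK ?posrE// x0.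
rewrite -!expRD /log_weight; congr expR.
by field.
Qed.

(** [- eps^-1 * expR (- (eps * ilog s.+1 y))] is an antiderivative of the density on the left. The
    convergence of the sum over shells rests on its boundedness. *)
Lemma expR_ilogB (s : nat) eps x y : 0 < eps ->
  (forall k, (k <= s)%N -> 0 < ilog k x) -> x <= y ->
  (y - x) * (expR (- (eps * ilog s.+1 y)) * \prod_(0 <= i < s.+1) (ilog i y)^-1) <=
  eps^-1 * (expR (- (eps * ilog s.+1 x)) - expR (- (eps * ilog s.+1 y))).
Proof.
move=> e0 x0 xy.
have := ilogB_ge x0 xy (leqnn s.+1); set P := \prod_(_ <= _ < _) _.
set lx := ilog s.+1 x; set ly := ilog s.+1 y => le.
have E0 := expR_ge0 (- (eps * ly)).
have -> : expR (- (eps * lx)) = expR (- (eps * ly)) * expR (eps * (ly - lx)).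
  by rewrite -expRD; congr expR; ring.
apply: (@le_trans _ _ (eps^-1 * (expR (- (eps * ly)) * (eps * (ly - lx))))).
  rewrite [leRHS](_ : _ = expR (- (eps * ly)) * (ly - lx)).
    by rewrite mulrCA ler_wpM2l.
  by field; rewrite gt_eqF.
rewrite ler_wpM2l ?invr_ge0 ?(ltW e0)//.
have := ler_wpM2l E0 (expR_ge1Dx (eps * (ly - lx))); lra.
Qed.

End IteratedLogarithms.

Section Shells.
Context {R : realType} {d : nat}.
Local Notation Zd := 'rV[int]_d.

(** Sup-norm cubes replace Euclidean balls because their points can be counted exactly; indexing by
    finite functions provides the count. *)
Definition box (k : nat) : seq Zd :=
  [seq (\row_j ((f j : nat)%:Z - k%:Z)) | f : {ffun 'I_d -> 'I_(k.*2.+1)}].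

Lemma size_box k : size (box k) = (k.*2.+1 ^ d)%N.
Proof. by rewrite size_map -cardE card_ffun !card_ord. Qed.

Lemma uniq_box k : uniq (box k).
Proof.
rewrite map_inj_uniq ?enum_uniq// => f g /rowP fg; apply/ffunP => j.
by have := fg j; rewrite !mxE => /addIr [] /val_inj.
Qed.

Lemma mem_boxP k (n : Zd) : reflect (forall j, (`|n ord0 j| <= k)%N) (n \in box k).
Proof.
apply: (iffP mapP) => [[f _ ->] j|nk].
  by rewrite mxE; case: (f j) => m /=; rewrite -addnn; lia.
exists [ffun j => inord (absz (n ord0 j + k%:Z)%R)]; first by rewrite mem_enum.
apply/rowP => j; rewrite mxE ffunE; move: (n ord0 j) (nk j) => m mk.
rewrite inordK -?addnn; lia.
Qed.

Lemma sub_box k l : (k <= l)%N -> {subset box k <= box l}.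
Proof.
by move=> kl n /mem_boxP nk; apply/mem_boxP => j; exact: leq_trans (nk j) kl.
Qed.

Lemma sum_box (G : Zd -> R) k : \sum_(n <- box k.+1) G n =
  \sum_(n <- box k) G n + \sum_(n <- box k.+1 | n \notin box k) G n.
Proof.
rewrite (bigID (mem (box k))) /=; congr (_ + _).
rewrite -big_filter; apply: perm_big; apply: uniq_perm.
- by rewrite filter_uniq ?uniq_box.
- exact: uniq_box.
move=> n; rewrite mem_filter andb_idr//; apply: sub_box; exact: leqnSn.
Qed.

Lemma count_shell k :
  count (fun n => n \notin box k) (box k.+1) = (k.*2.+3 ^ d - k.*2.+1 ^ d)%N.
Proof.
rewrite -(size_box k.+1) -(size_box k).
have -> : size (box k) = count (mem (box k)) (box k.+1).
  rewrite -size_filter; apply: perm_size; apply: uniq_perm.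
  - exact: uniq_box.
  - by rewrite filter_uniq ?uniq_box.
  by move=> n; rewrite mem_filter andb_idr//; apply: sub_box; exact: leqnSn.
by rewrite -(count_predC (mem (box k)) (box k.+1)) addKn.
Qed.

Lemma summ_bounded_box (G : Zd -> R) (M : R) : (forall n, 0 <= G n) ->
  (forall k, \sum_(n <- box k) G n <= M) -> summ G.
Proof.
move=> G0 GM; apply: (@le_lt_trans _ _ M%:E); last exact: ltry.
apply: ge_ereal_sup => _ [A /= [/finite_seqP[s sA] _] <-].
have [K sK] : exists K, {subset s <= box K}.
  elim: s {sA} => [|m s [K sK]]; first by exists 0%N.
  exists (maxn K (\max_j `|m ord0 j|%N)) => n; rewrite in_cons => /predU1P[->|/sK nK].
    by apply/mem_boxP => j; rewrite leq_max (leq_bigmax j) orbT.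
  by apply: sub_box nK; exact: leq_maxl.
apply: (@le_trans _ _ (\sum_(n \in [set` box K]) `|G n|%:E)%E).
  apply: lee_fsum_nneg_subset => //.
  - by rewrite sA; exact: finite_seq.
  - exact: finite_seq.
  - by move=> n; rewrite sA !mem_setE => /sK.
rewrite fsumEFin; last exact: finite_seq.
rewrite lee_fin -fsbig_seq ?uniq_box//.
by under eq_bigr do rewrite ger0_norm //.
Qed.

(** The partial sum over [box k] plus [e k] is nonincreasing from [k0] on: the next shell has as
    many points as the difference of powers says, each contributing at most [b k]. *)
Lemma summ_shells (G : Zd -> R) (b e : nat -> R) k0 : (forall n, 0 <= G n) ->
  (forall k n, (k0 <= k)%N -> n \notin box k -> G n <= b k) ->
  (forall k, (k0 <= k)%N ->
     ((k.*2.+3 ^ d)%:R - (k.*2.+1 ^ d)%:R) * b k <= e k - e k.+1) ->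
  (forall k, (k0 <= k)%N -> 0 <= e k) -> summ G.
Proof.
move=> G0 Gb be e0.
have bound k : (k0 <= k)%N ->
    \sum_(n <- box k) G n + e k <= \sum_(n <- box k0) G n + e k0.
  elim: k => [|k ih]; first by rewrite leqn0 => /eqP ->.
  rewrite leq_eqVlt => /predU1P[->//|]; rewrite ltnS => k0k.
  apply: le_trans (ih k0k); rewrite sum_box -addrA lerD2l -lerBrDr.
  apply: le_trans (be k k0k).
  apply: (@le_trans _ _ (\sum_(n <- box k.+1 | n \notin box k) b k)).
    by apply: ler_sum => n nk; exact: Gb.
  rewrite -natrB; last first.
    have [d0|d0] := posnP d; first by rewrite d0.
    by rewrite leq_exp2r//; exact: leq_trans (leqnSn _) (leqnSn _).
  by rewrite mulr_natl big_const_seq iter_addr_0 count_shell.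
apply: (@summ_bounded_box _ (\sum_(n <- box k0) G n + e k0)) => // k.
have [k0k|kk0] := leqP k0 k.
  by apply: le_trans (bound k k0k); rewrite lerDl e0.
apply: (@le_trans _ _ (\sum_(n <- box k0) G n)); last by rewrite lerDl e0.
have := kk0; elim: k0 {Gb be e0 bound kk0} => // l ih; rewrite ltnS leq_eqVlt.
move=> /predU1P[->|/ih le]; rewrite sum_box ?lerDl ?sumr_ge0//.
by apply: le_trans le _; rewrite lerDl sumr_ge0.
Qed.

Lemma enorm_notin_box k (n : Zd) : n \notin box k -> k.+1%:R <= enorm R n.
Proof.
move=> /mem_boxP nk; have [j kj] : exists j, (k < `|n ord0 j|)%N.
  apply: contrapT => ex; apply: nk => j; rewrite leqNgt; apply/negP => kj.
  by apply: ex; exists j.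
have -> : (k.+1%:R : R) = Num.sqrt (k.+1%:R ^+ 2) by rewrite sqrtr_sqr ger0_norm.
rewrite ler_sqrt; last by apply: sumr_ge0 => i _; exact: sqr_ge0.
rewrite (bigD1 j)//= ler_wpDr//; first by apply: sumr_ge0 => i _; exact: sqr_ge0.
rewrite -[leRHS]real_normK ?num_real// lerXn2r ?nnegrE// -intr_norm.
by rewrite -[k.+1%:R]/((k.+1)%:~R) ler_int -abszE lez_nat.
Qed.

Lemma finite_enorm_lt (N : R) : finite_set [set n : Zd | enorm R n < N].
Proof.
have [k Nk] : exists k, N <= k.+1%:R.
  exists (Num.truncn `|N|).
  by apply: le_trans (ler_norm N) _; apply: ltW; exact: truncnS_gt.
apply: sub_finite_set (finite_seq (box k)) => n /= nN.
by apply: contraLR nN => /enorm_notin_box; rewrite -leNgt; exact: le_trans.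
Qed.

Lemma expB_le (n : nat) (x y : R) : 0 <= y -> y <= x ->
  x ^+ n.+1 - y ^+ n.+1 <= n.+1%:R * (x - y) * x ^+ n.
Proof.
move=> y0 yx; have x0 := le_trans y0 yx.
elim: n => [|n ih]; first by rewrite !expr1 expr0 mulr1 mul1r.
have -> : x ^+ n.+2 - y ^+ n.+2 = (x - y) * x ^+ n.+1 + y * (x ^+ n.+1 - y ^+ n.+1).
  by rewrite !(exprS _ n.+1); ring.
apply: (@le_trans _ _ ((x - y) * x ^+ n.+1 + x * (n.+1%:R * (x - y) * x ^+ n))).
  rewrite lerD2l; apply: ler_pM => //.
  by rewrite subr_ge0 lerXn2r ?nnegrE.
by rewrite [in leRHS]exprS [in leLHS]exprS -[n.+2%:R]natr1; lra.
Qed.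

End Shells.

(** * The comparison function *)

Section WeightSummable.
Context {R : realType}.

Definition weight (d s : nat) (eps : R) (n : 'rV[int]_d) : R :=
  expR (- log_weight (d%:R / 2) s eps (enorm R n)).

Lemma l2r_weight (d s : nat) (eps N : R) : (0 < d)%N -> 0 < eps ->
  (forall x, N <= x -> forall k, (k <= s)%N -> 0 < ilog k x) ->
  l2r (fun n : 'rV[int]_d =>
    if n \in [set n | N <= enorm R n] then weight s eps n else 0).
Proof.
case: d => // d _ e0 NP; set G := fun n => _.
have e2 : 0 < 2 * eps by rewrite mulr_gt0.
(* The dimension is now [d.+1]: a shell has at most [2 (d + 1) (2k + 3)^d] points, and
   [2k + 3 <= 3 (k + 1)]. *)
pose C : R := 2 * d.+1%:R * 3 ^+ d.
pose b (k : nat) : R := expR (- (2 * log_weight (d.+1%:R / 2) s eps k.+1%:R)).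
pose e (k : nat) : R := C * ((2 * eps)^-1 * expR (- (2 * eps * ilog s.+1 k%:R))).
pose k0 := (Num.truncn `|N|).+1.
have k0N k : (k0 <= k)%N -> N <= k%:R.
  move=> kk; apply: le_trans (ler_norm N) _; apply: ltW.
  by apply: lt_le_trans (truncnS_gt _) _; rewrite ler_nat.
apply: (@summ_shells R d.+1 _ b e k0) => [n|k n kk nk|k kk|k kk].
- exact: sqr_ge0.
- have kN := k0N _ (leqW kk); have kn := @enorm_notin_box R _ _ _ nk.
  rewrite /G mem_set/=; last exact: le_trans kN kn.
  rewrite /weight -expRM_natl ler_expR mulrN lerN2 ler_pM2l//.
  by apply: ler_log_weight => //; [exact: ltW|exact: NP].
- have k1 : 0 < k.+1%:R :> R by rewrite ltr0n.
  have kN := k0N _ kk; have kN1 := k0N _ (leqW kk).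
  have b0 : 0 <= b k by exact: expR_ge0.
  have kE : k.*2.+3%:R = 2 * k.+1%:R + 1 :> R.
    by rewrite -addnn -!natr1 natrD; ring.
  have kE' : k.*2.+1%:R = 2 * k.+1%:R - 1 :> R.
    by rewrite -addnn -!natr1 natrD; ring.
  have le1 : 1 <= k.+1%:R :> R by rewrite ler1n.
  rewrite !natrX; apply: (@le_trans _ _ (C * k.+1%:R ^+ d * b k)).
    have h1 : 0 <= k.*2.+1%:R :> R by rewrite ler0n.
    have h2 : k.*2.+1%:R <= k.*2.+3%:R :> R by rewrite kE kE'; lra.
    rewrite ler_wpM2r//; apply: le_trans (expB_le d h1 h2) _.
    have xd : k.*2.+3%:R ^+ d <= 3 ^+ d * k.+1%:R ^+ d :> R.
      by rewrite -exprMn lerXn2r ?nnegrE ?mulr_ge0// kE; lra.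
    have -> : d.+1%:R * (k.*2.+3%:R - k.*2.+1%:R) = 2 * d.+1%:R :> R.
      by rewrite kE kE'; ring.
    by rewrite /C -[leRHS]mulrA ler_wpM2l ?mulr_ge0.
  (* The count has one power of [k + 1] less than the volume factor; the missing inverse is the
     factor of index 0 of the product. *)
  have Ek : k.+1%:R ^+ d * b k = expR (- (2 * eps * ilog s.+1 k.+1%:R)) *
      \prod_(0 <= i < s.+1) (ilog i k.+1%:R)^-1.
    have E1 : b k * k.+1%:R ^+ d.+1 = _ := expR_log_weight d.+1 eps (NP _ kN1).
    rewrite big_ltn// mulrCA -E1 exprS mulrCA mulKf ?gt_eqF//.
    by rewrite mulrC.
  rewrite -mulrA Ek /e -!mulrBr ler_wpM2l//.
    by rewrite !mulr_ge0// exprn_ge0.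
  have kk1 : k%:R <= k.+1%:R :> R by rewrite ler_nat.
  have := expR_ilogB e2 (NP _ kN) kk1.
  by rewrite (_ : k.+1%:R - k%:R = 1) ?mul1r// -natr1; ring.
- by rewrite /e !mulr_ge0 ?invr_ge0 ?exprn_ge0 ?(ltW e2) ?expR_ge0.
Qed.

Lemma enorm_basisv_le (d : nat) (n : 'rV[int]_d) j :
  enorm R (n + basisv j) ^+ 2 = enorm R n ^+ 2 + (2 * (n ord0 j)%:~R + 1) /\
  enorm R (n - basisv j) ^+ 2 = enorm R n ^+ 2 - 2 * (n ord0 j)%:~R + 1.
Proof.
have E (m : 'rV[int]_d) : enorm R m ^+ 2 = \sum_(i < d) (m ord0 i)%:~R ^+ 2.
  by rewrite sqr_sqrtr// sumr_ge0// => i _; exact: sqr_ge0.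
rewrite !E [X in _ = X + _](bigD1 j)//= [X in _ = X - _ + _](bigD1 j)//=.
rewrite (bigD1 j)//= [X in _ /\ X = _](bigD1 j)//=.
have S (c : int) : \sum_(i < d | i != j) ((n + c *: basisv j) ord0 i)%:~R ^+ 2 =
    \sum_(i < d | i != j) (n ord0 i)%:~R ^+ 2 :> R.
  apply: eq_bigr => i ij.
  by rewrite /basisv !mxE (negbTE ij) andbF mulr0 addr0.
have := S 1; have := S (-1); rewrite scale1r scaleN1r => -> ->.
by rewrite /basisv !mxE !eqxx/= rmorphD rmorphB /=; split; ring.
Qed.

Lemma enorm_coord (d : nat) (n : 'rV[int]_d) j : `|(n ord0 j)%:~R| <= enorm R n.
Proof.
rewrite -sqrtr_sqr ler_sqrt; last by apply: sumr_ge0 => i _; exact: sqr_ge0.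
by rewrite (bigD1 j)//= lerDl sumr_ge0// => i _; exact: sqr_ge0.
Qed.

Lemma enorm_shift_ge (d : nat) (n : 'rV[int]_d) j :
  enorm R n - 1 <= enorm R (n + basisv j) /\ enorm R n - 1 <= enorm R (n - basisv j).
Proof.
have [Ep Em] := enorm_basisv_le n j.
have := enorm_coord n j; rewrite ler_norml => /andP[c1 c2].
have n0 : 0 <= enorm R n by exact: sqrtr_ge0.
have p0 : 0 <= enorm R (n + basisv j) by exact: sqrtr_ge0.
have m0 : 0 <= enorm R (n - basisv j) by exact: sqrtr_ge0.
by split; nra.
Qed.

(** The summands in the first condition on V are therefore the quotients [g(m) / g(n)] over the
    neighbours [m] of [n]. *)
Lemma ratio_weight (d s : nat) (eps r r' : R) :
  (forall k, (k <= s)%N -> 0 < ilog k r) -> (forall k, (k <= s)%N -> 0 < ilog k r') ->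
  (r / r') `^ (d%:R / 2) *
    (\prod_(1 <= i < s.+1) Num.sqrt (ilog i r / ilog i r')) *
    (ilog s r / ilog s r') `^ eps =
  expR (log_weight (d%:R / 2) s eps r - log_weight (d%:R / 2) s eps r').
Proof.
move=> rp rp'.
have pE k p : (k <= s)%N -> (ilog k r / ilog k r') `^ p =
    expR (p * (ilog k.+1 r - ilog k.+1 r')).
  move=> ks; have r0 := rp k ks; have r0' := rp' k ks.
  rewrite /powR gt_eqF ?divr_gt0// ln_div ?posrE//.
rewrite (pE s)// (pE 0%N)//.
have -> : \prod_(1 <= i < s.+1) Num.sqrt (ilog i r / ilog i r') =
    expR (2^-1 * (\sum_(1 <= i < s.+1) ilog i.+1 r - \sum_(1 <= i < s.+1) ilog i.+1 r')).
  rewrite -sumrB mulr_sumr expR_sum !big_nat; apply: eq_bigr => i /andP[i1 si].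
  rewrite -powR12_sqrt; first exact: pE.
  by rewrite divr_ge0 ?ltW ?rp ?rp'.
rewrite -!expRD /log_weight; congr expR; ring.
Qed.

Lemma eigenvalue_of_weight (d s : nat) (eps : R) (V : 'rV[int]_d -> R) : (0 < d)%N ->
  0 < eps -> critical_from_above V (4 * d%:R) ->
  (exists N : R, forall n : 'rV[int]_d, N <= enorm R n ->
    nbsum (weight s eps) n <= (2 * d%:R - V n) * weight s eps n) ->
  point_spectrum (schrodinger V) (4 * d%:R)%:C.
Proof.
move=> d0 e0 crit [N NP].
have [X XP] := @ilog_large R s 1.
have X0 x : X <= x -> forall k, (k <= s)%N -> 0 < ilog k x.
  by move=> Xx k ks; apply: lt_le_trans ltr01 _; exact: XP.
have le : (sup_real (spectrum (schrodinger V)) <= (4 * d%:R)%:E)%E by rewrite crit.1.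
have usup := positive_supersolution ((sup_spectrum_le V _).1 le).
(* The margin 1 keeps the neighbours of points of norm at least [N'] in the region where all
   logarithms are positive. *)
pose N' := Num.max N (X + 1).
have [|||||||v [v0 lv Tv]] := @l2_solution R d (top_potential V (4 * d%:R))
  (weight s eps) [set n | X <= enorm R n] [set n | N' <= enorm R n] usup.
- exact: critical_solution crit.
- by move=> n /=; rewrite /N' ge_max => /andP[_]; lra.
- rewrite (_ : ~` _ = [set n | enorm R n < N']); first exact: finite_enorm_lt.
  by apply/seteqP; split=> n /=; rewrite ltNge => /negP.
- move=> n j /=; rewrite /N' ge_max => /andP[_ Xn].
  by have [? ?] := enorm_shift_ge n j; split; lra.
- by move=> n _; exact: expR_gt0.
- move=> n /=; rewrite /N' ge_max => /andP[Nn _].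
  apply: le_trans (NP n Nn) _; rewrite ler_wpM2r ?expR_ge0// /top_potential.
  by lra.
- exact: l2r_weight.
by apply: eigenvalue_of_solution lv Tv; exists 0; rewrite gt_eqF.
Qed.

End WeightSummable.

(** * Taylor estimates *)

Section Taylor.
Context {R : realType}.
Implicit Types x y u : R.

Lemma ge0_derive_le (f df : R -> R) (b : R) :
  (forall x, is_derive x 1 f (df x)) -> (forall x, 0 <= x <= b -> 0 <= df x) ->
  forall x, 0 <= x <= b -> f 0 <= f x.
Proof.
move=> fdf df0 x /andP[x0 xb].
have fc : {within `[0, x], continuous f}.
  apply: continuous_subspaceT => y.
  by apply: differentiable_continuous; apply/derivable1_diffP; exact: ex_derive.
have [c] := MVT_segment x0 (fun y _ => fdf y) fc.
rewrite in_itv /= subr0 => /andP[c0 cx] e.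
by rewrite -subr_ge0 e mulr_ge0// df0// c0 (le_trans cx).
Qed.

(** [e^x (1 - x + x^2 / 2)] has derivative [e^x x^2 / 2 >= 0], so it is at least 1 at [x = - u];
    then multiply by [e^u]. *)
Lemma expR_le_quadratic u : u <= 0 -> expR u <= 1 + u + u ^+ 2 / 2.
Proof.
move=> u0; pose f := (expR : R -> R) * (cst 1 - id + 2^-1 *: (id * id)).
pose df := fun x : R => expR x * (x ^+ 2 / 2).
have fE x : f x = expR x * (1 - x + 2^-1 * (x * x)) by [].
have fdf x : is_derive x 1 f (df x).
  have h : is_derive x 1 (cst 1 - id + 2^-1 *: ((id : R -> R) * id))
      (0 - 1 + 2^-1 * (x * 1 + x * 1)).
    have h1 := @is_derive_id R R x 1.
    exact: (is_deriveD (is_deriveB (is_derive_cst (1 : R) x 1) h1)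
      (is_deriveZ 2^-1 (is_deriveM h1 h1))).
  apply: (is_derive_eq (is_deriveM (is_derive_expR x) h)).
  rewrite (_ : (cst 1 - id + 2^-1 *: (id * id)) x = 1 - x + 2^-1 * (x * x))//.
  by rewrite /df /GRing.scale /=; move: (expR x) => e; field.
have := @ge0_derive_le f df (- u) fdf _ (- u).
rewrite oppr_ge0 u0 lexx !fE expR0 => /(_ _ isT) H.
have : 1 <= expR (- u) * (1 - - u + 2^-1 * (- u * - u)).
  apply: le_trans (H _); first by lra.
  by move=> x _; rewrite mulr_ge0 ?expR_ge0// divr_ge0// sqr_ge0.
move=> /(ler_wpM2l (expR_ge0 u)); rewrite mulr1 [leRHS]mulrA -expRD subrr expR0 mul1r.
by move=> /le_trans; apply; lra.
Qed.

Lemma expR_le_cubic u : `|u| <= 1 -> expR u <= 1 + u + u ^+ 2 / 2 + `|u| ^+ 3.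
Proof.
move=> u1; have [u0|u0] := leP u 0.
  by apply: le_trans (expR_le_quadratic u0) _; rewrite lerDl exprn_ge0.
rewrite ger0_norm ?(ltW u0)// in u1 *.
(* The derivative [e^(- x) x^2 (5 / 2 - x)] is nonnegative on [0, 1], so [f >= f 0 = 1] there. *)
pose f := ((expR : R -> R) \o -%R) *
  (cst 1 + id + 2^-1 *: (id * id) + (id * (id * id))).
pose df := fun x : R => expR (- x) * (x ^+ 2 * (5 / 2 - x)).
have fE x : f x = expR (- x) * (1 + x + 2^-1 * (x * x) + x * (x * x)) by [].
have fdf x : is_derive x 1 f (df x).
  have h : is_derive x 1 (cst 1 + id + 2^-1 *: ((id : R -> R) * id) + (id * (id * id)))
      (0 + 1 + 2^-1 * (x * 1 + x * 1) + (x * (x * 1 + x * 1) + (x * x) * 1)).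
    have h1 := @is_derive_id R R x 1; have h2 := is_deriveM h1 h1.
    exact: (is_deriveD (is_deriveD (is_deriveD (is_derive_cst (1 : R) x 1) h1)
      (is_deriveZ 2^-1 h2)) (is_deriveM h1 h2)).
  have hN : is_derive x 1 ((expR : R -> R) \o -%R) (expR (- x) * -1).
    by apply: is_derive1_comp.
  apply: (is_derive_eq (is_deriveM hN h)).
  rewrite (_ : (cst 1 + id + 2^-1 *: (id * id) + _) x =
    1 + x + 2^-1 * (x * x) + x * (x * x))//.
  by rewrite /df /GRing.scale /=; move: (expR (- x)) => e; field.
have := @ge0_derive_le f df u fdf _ u.
rewrite lexx (ltW u0) !fE oppr0 expR0 => /(_ _ isT) H.
have : 1 <= expR (- u) * (1 + u + 2^-1 * (u * u) + u * (u * u)).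
  apply: le_trans (H _); first by lra.
  move=> x /andP[x0 xu]; rewrite !mulr_ge0 ?expR_ge0 ?sqr_ge0//; lra.
move=> /(ler_wpM2l (expR_ge0 u)); rewrite mulr1 [leRHS]mulrA -expRD subrr expR0 mul1r.
by move=> /le_trans; apply; lra.
Qed.

(* Upper bound for [(1 + x) `^ (- B)], the constant being uniform in bounded [B]. *)
Lemma expR_ln_taylor B x : 0 <= B -> `|x| <= 8^-1 -> 2 * B * `|x| <= 1 ->
  expR (- (B * ln (1 + x))) <=
  1 - B * x + B * (B + 1) / 2 * x ^+ 2 + (4 * B + 2 * B ^+ 2 + 8 * B ^+ 3) * `|x| ^+ 3.
Proof.
move=> B0 x8 Bx; set y := `|x| in x8 Bx *.
have y0 : 0 <= y by exact: normr_ge0.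
have xy2 : x ^+ 2 = y ^+ 2 by rewrite real_normK ?num_real.
have := x8; rewrite ler_norml => /andP[xl xr].
(* [L] will be a lower bound for [ln (1 + x)]: in the expansion of [e^L] the coefficient 4 outweighs
   the [3 / 2 + 2] coming from [L^2 / 2] and [|L|^3]. *)
pose r := x ^+ 2 / 2 + 4 * y ^+ 3; pose L := x - r.
have r0 : 0 <= r by rewrite /r addr_ge0 ?divr_ge0 ?sqr_ge0// mulr_ge0 ?exprn_ge0.
have ry : r <= y ^+ 2.
  have : y ^+ 3 <= 8^-1 * y ^+ 2 by rewrite exprS ler_wpM2r ?sqr_ge0.
  by rewrite /r xy2; lra.
have y2 : y ^+ 2 <= 8^-1 * y by rewrite expr2 ler_wpM2r.
have Ly : `|L| <= y + r by rewrite /L (le_trans (ler_normB _ _))// (ger0_norm r0).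
have yr0 : 0 <= y + r by exact: addr_ge0.
have yy0 : 0 <= y + y ^+ 2 by rewrite addr_ge0 ?sqr_ge0.
have Ly' : `|L| <= 9 / 8 * y by lra.
have L2 : L ^+ 2 <= y ^+ 2 + 3 * y ^+ 3.
  have : L ^+ 2 <= (y + r) ^+ 2.
    by rewrite -(real_normK (num_real L)) lerXn2r ?nnegrE.
  have : (y + r) ^+ 2 <= (y + y ^+ 2) ^+ 2.
    by rewrite lerXn2r ?nnegrE ?lerD2l.
  have : (y ^+ 2) ^+ 2 <= y ^+ 3.
    have -> : (y ^+ 2) ^+ 2 = y * y ^+ 3 by ring.
    by rewrite ler_piMl ?exprn_ge0//; lra.
  have -> : (y + y ^+ 2) ^+ 2 = y ^+ 2 + 2 * y ^+ 3 + (y ^+ 2) ^+ 2 by ring.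
  by lra.
have L3 : `|L| ^+ 3 <= 2 * y ^+ 3.
  apply: (@le_trans _ _ ((9 / 8 * y) ^+ 3)).
    by rewrite lerXn2r ?nnegrE ?mulr_ge0.
  by rewrite exprMn ler_wpM2r ?exprn_ge0//; lra.
have lnL : L <= ln (1 + x).
  rewrite -(expRK L) ler_ln ?posrE ?expR_gt0//; last by lra.
  have L1 : `|L| <= 1 by lra.
  apply: le_trans (expR_le_cubic L1) _.
  have y3 : 0 <= y ^+ 3 by rewrite exprn_ge0.
  by rewrite /L in L2 L3 *; rewrite /r in L2 L3 *; rewrite xy2 in L2 L3 *; lra.
have BL : `|- (B * L)| <= 1.
  rewrite normrN normrM (ger0_norm B0); apply: le_trans Bx.
  by have := ler_wpM2l B0 Ly'; have := mulr_ge0 B0 y0; lra.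
apply: (@le_trans _ _ (expR (- (B * L)))).
  by rewrite ler_expR lerN2 ler_wpM2l.
apply: le_trans (expR_le_cubic BL) _.
rewrite sqrrN normrN normrM (ger0_norm B0) !exprMn.
have := ler_wpM2l (sqr_ge0 B) L2.
have := ler_wpM2l (exprn_ge0 3 B0) L3.
have B3 : 0 <= B ^+ 3 * y ^+ 3 by rewrite mulr_ge0 ?exprn_ge0.
have B2 : 0 <= B ^+ 2 * y ^+ 3 by rewrite mulr_ge0 ?exprn_ge0.
by rewrite /L /r xy2; lra.
Qed.

Lemma ln1D_bounds y : `|y| <= 2^-1 ->
  [/\ ln (1 + y) <= y, y - 2 * y ^+ 2 <= ln (1 + y) & `|ln (1 + y)| <= 2 * `|y|].
Proof.
move=> y2; have := y2; rewrite ler_norml => /andP[yl yr].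
have y0 : 0 < 1 + y by lra.
have up : ln (1 + y) <= y.
  by have := expR_ge1Dx (ln (1 + y)); rewrite lnK ?posrE//; lra.
have lo : y - 2 * y ^+ 2 <= ln (1 + y).
  have := expR_ge1Dx (- ln (1 + y)).
  rewrite expRN lnK ?posrE// => le.
  have : (1 + y)^-1 <= 1 - y + 2 * y ^+ 2.
    rewrite -[leLHS]mul1r ler_pdivrMr//.
    have : 0 <= y ^+ 2 * (1 + 2 * y) by rewrite mulr_ge0 ?sqr_ge0//; lra.
    by lra.
  by lra.
split=> //; rewrite ler_norml; apply/andP; split.
  have yn : y ^+ 2 <= 2^-1 * `|y|.
    by rewrite -(real_normK (num_real y)) expr2 ler_wpM2r.
  have := lerNnormlW (lexx `|y|); lra.
by have := ler_norm y; have := normr_ge0 y; lra.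
Qed.

End Taylor.

(** * Increments of iterated logarithms *)

Section Asymptotics.
Context {R : realType}.
Implicit Types r x y z : R.

(** Peeling off [ln x] leaves the shorter product at [ln x], which by induction is at most [ln x];
    and [(ln x)^2] is small against [x], since [e^y >= y^3 / 6]. *)
Lemma prod_ilog_small (s : nat) (eta : R) : 0 < eta ->
  exists X, forall x, X <= x -> \prod_(1 <= k < s.+1) ilog k x <= eta * x.
Proof.
move=> eta0; elim: s eta eta0 => [|s ih] eta eta0.
  exists eta^-1 => x; rewrite big_geq// => ex.
  by rewrite -ler_pdivrMl// mulr1.
have [X XP] := ih 1 ltr01.
have [X1 X1P] := @ilog_large R s.+1 1.
pose Y := Num.max X (Num.max (6 / eta) 0); exists (Num.max X1 (expR Y)) => x.
rewrite ge_max => /andP[X1x Yx].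
have xp : 0 < x := lt_le_trans (expR_gt0 _) Yx.
have Yl : Y <= ln x by rewrite -(expRK Y) ler_ln ?posrE ?expR_gt0.
move: Yl; rewrite /Y !ge_max => /andP[Xl /andP[el l0]].
have -> : \prod_(1 <= k < s.+2) ilog k x = ln x * \prod_(1 <= k < s.+1) ilog k (ln x).
  rewrite big_ltn// big_add1 /=; congr (_ * _); apply: eq_bigr => k _.
  by rewrite /ilog -iterSr.
apply: (@le_trans _ _ (ln x * ln x)).
  by rewrite ler_wpM2l//; have := XP _ Xl; rewrite mul1r.
set y := ln x in el l0 *.
have -> : x = expR y by rewrite lnK ?posrE.
have := @expR_ge1Dxn R y 2 l0; rewrite (_ : (3`!)%:R = 6)// => le.
have : y ^+ 3 / 6 <= expR y by lra.
move=> /(ler_wpM2l (ltW eta0)); apply: le_trans.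
rewrite (_ : eta * (y ^+ 3 / 6) = (eta * y / 6) * (y * y)); last by ring.
rewrite ler_peMl ?mulr_ge0//.
by rewrite ler_pdivlMr// mul1r mulrC -ler_pdivrMr.
Qed.

(** Derivative of [ilog i.+1] with respect to [ln r], and also the product in the second
    condition. *)
Definition invprod (i : nat) r : R := \prod_(1 <= k < i.+1) (ilog k r)^-1.

Lemma invprodS i r : invprod i.+1 r = invprod i r / ilog i.+1 r.
Proof. by rewrite /invprod big_nat_recr. Qed.

Lemma invprod0 r : invprod 0 r = 1.
Proof. by rewrite /invprod big_geq. Qed.

Lemma invprod_bounds (s i : nat) r : (forall k, (k <= s)%N -> 1 <= ilog k r) ->
  (i <= s)%N -> 0 < invprod i r <= 1.
Proof.
move=> r1; elim: i => [|i ih] is_; first by rewrite invprod0 ltr01 lexx.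
have /andP[p0 p1] := ih (ltnW is_); have l1 := r1 _ is_.
have l0 : 0 < ilog i.+1 r by apply: lt_le_trans l1.
rewrite invprodS divr_gt0//= ler_pdivrMr// mul1r.
exact: le_trans p1 l1.
Qed.

Lemma invprod_le1 (s i : nat) r : (forall k, (k <= s)%N -> 1 <= ilog k r) ->
  (0 < i <= s)%N -> invprod i r <= (ilog 1 r)^-1.
Proof.
move=> r1; elim: i => // -[|i] ih /andP[_ is_].
  by rewrite invprodS invprod0 mul1r.
have /andP[p0 p1] := invprod_bounds r1 (ltnW is_); have l1 := r1 _ is_.
have l0 : 0 < ilog i.+2 r by apply: lt_le_trans l1.
apply: le_trans (ih (ltnW is_)).
by rewrite invprodS ler_pdivrMr// ler_peMr// ltW.
Qed.

(** From [z i.+1 = ln (1 + z i / ilog i.+1 r)], by induction. The third bound keeps the argument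
    small enough for the next logarithm; the factor [4 ^+ i] suffices because
    [4^i + 2 * 4^i <= 4^(i + 1)]. The case [i = 0] is exact, so [delta] concerns only [i > 0]. *)
Lemma ilog_increment (s : nat) r r' (delta : R) :
  (forall k, (k <= s)%N -> 1 <= ilog k r) -> (forall k, (k <= s)%N -> 0 < ilog k r') ->
  0 <= delta -> (forall i, (0 < i <= s)%N -> invprod i r ^+ 2 <= delta) ->
  let z i := ilog i.+1 r' - ilog i.+1 r in
  2 ^+ s * `|z 0%N| <= 2^-1 ->
  forall i, (i <= s)%N ->
  [/\ z i <= invprod i r * z 0%N,
      invprod i r * z 0%N - 4 ^+ i * delta * z 0%N ^+ 2 <= z i &
      `|z i| <= 2 ^+ i * invprod i r * `|z 0%N|].
Proof.
move=> r1 r1' delta0 dP z z0s.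
set z0 := z 0%N in z0s *.
elim=> [|i ih] is_.
  rewrite invprod0 expr0 !mul1r -/z0; split=> //.
  by rewrite gerBl mulr_ge0 ?sqr_ge0.
have [up lo ab] := ih (ltnW is_).
have /andP[p0 p1] := invprod_bounds r1 (ltnW is_).
have /andP[q0 q1] := invprod_bounds r1 is_.
have l1 := r1 _ is_; have l0 : 0 < ilog i.+1 r by apply: lt_le_trans l1.
have l0' := r1' _ is_.
have li1 : (ilog i.+1 r)^-1 <= 1 by rewrite invf_le1.
have li0 : 0 < (ilog i.+1 r)^-1 by rewrite invr_gt0.
set y := z i / ilog i.+1 r.
have zE : z i.+1 = ln (1 + y).
  rewrite /z (ilogS i.+1 r') (ilogS i.+1 r) -ln_div ?posrE//; congr ln.
  by rewrite /y /z mulrBl divff ?gt_eqF// addrC subrK.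
have yab : `|y| <= 2 ^+ i * invprod i.+1 r * `|z0|.
  rewrite /y normrM [X in _ * X]gtr0_norm// invprodS.
  by rewrite mulrA mulrAC ler_wpM2r ?(ltW li0)//.
have pow_le : 2 ^+ i <= 2 ^+ s :> R by rewrite ler_eXn2l ?ltr1n// ltnW.
have y2 : `|y| <= 2^-1.
  apply: le_trans yab _; apply: le_trans z0s; rewrite ler_wpM2r//.
  by apply: le_trans pow_le; rewrite ler_piMr// exprn_ge0.
have [lnu lnl lna] := ln1D_bounds y2.
rewrite zE; split.
- apply: le_trans lnu _; rewrite /y invprodS mulrAC ler_wpM2r//; exact: ltW.
- apply: le_trans lnl.
  have nn : 0 <= 4 ^+ i * delta * z0 ^+ 2.
    by apply: mulr_ge0 (sqr_ge0 _); apply: mulr_ge0 => //; exact: exprn_ge0.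
  have ylo : invprod i.+1 r * z0 - 4 ^+ i * delta * z0 ^+ 2 <= y.
    apply: (@le_trans _ _ ((invprod i r * z0 - 4 ^+ i * delta * z0 ^+ 2) / ilog i.+1 r)).
      rewrite mulrBl invprodS mulrAC lerD2l lerN2.
      exact: ler_piMr.
    by rewrite /y ler_wpM2r// ltW.
  have ysq : y ^+ 2 <= 4 ^+ i * delta * z0 ^+ 2.
    rewrite -(real_normK (num_real y)) -(real_normK (num_real z0)).
    apply: (@le_trans _ _ ((2 ^+ i * invprod i.+1 r * `|z0|) ^+ 2)).
      by rewrite lerXn2r ?nnegrE// !mulr_ge0 ?exprn_ge0// ltW.
    rewrite !exprMn ler_wpM2r ?sqr_ge0// -exprM mulnC exprM.
    rewrite (_ : 2 ^+ 2 = 4)//; last by rewrite -natrX.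
    by rewrite ler_wpM2l ?exprn_ge0// dP.
  by rewrite exprS; lra.
- apply: le_trans lna _; rewrite exprS -!mulrA ler_pM2l//.
  by rewrite mulrA.
Qed.

End Asymptotics.

Section Neighbours.
Context {R : realType}.
Implicit Types r x y z : R.

Definition invlog_sqr (s : nat) r : R := if s is 0 then 0 else (ilog 1 r)^-1 ^+ 2.

(** The errors of the expansion have relative order [1 / r] and [1 / log^2 r]; both are negligible
    against the last term of the second condition. *)
Lemma invprod_large (s : nat) (eta : R) : 0 < eta ->
  exists X, forall r, X <= r ->
    r^-1 <= eta * invprod s r /\ invlog_sqr s r <= eta * invprod s r.
Proof.
move=> eta0; have [X1 X1P] := @ilog_large R s 1.
have [X2 X2P] := prod_ilog_small s eta0.
have [X3 X3P] := prod_ilog_small s.-1 eta0.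
exists (Num.max (Num.max X1 X2) (expR X3)) => r; rewrite !ge_max -andbA => /and3P[r1 r2 r3].
have rp : 0 < r := lt_le_trans (expR_gt0 _) r3.
have iP t : \prod_(1 <= k < t.+1) (ilog k r)^-1 = (\prod_(1 <= k < t.+1) ilog k r)^-1.
  by rewrite prodfV.
have /andP[p0 _] := invprod_bounds (X1P _ r1) (leqnn s).
have pE : invprod s r = (\prod_(1 <= k < s.+1) ilog k r)^-1 by rewrite /invprod iP.
have M0 : 0 < \prod_(1 <= k < s.+1) ilog k r by rewrite -invr_gt0 -pE.
split.
  by rewrite pE ler_pdivlMr// mulrC ler_pdivrMr// X2P.
case: s {r2 X2P} X1P X3P r1 r3 p0 iP pE M0 => [|s] X1P X3P r1 r3 p0 iP pE M0.
  by rewrite mulr_ge0// ltW.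
have l1 : 0 < ilog 1 r by apply: lt_le_trans ltr01 _; exact: X1P.
have Xl : X3 <= ilog 1 r by rewrite -(expRK X3) ler_ln ?posrE ?expR_gt0.
have := X3P _ Xl; rewrite /= => le.
rewrite /= expr2 pE.
(* With one logarithm cancelled, what remains is [prod_ilog_small] at [ilog 1 r], with one factor
   fewer. *)
have ME : \prod_(1 <= k < s.+2) ilog k r = ilog 1 r * \prod_(1 <= k < s.+1) ilog k (ilog 1 r).
  rewrite big_ltn// big_add1 /=; congr (_ * _); apply: eq_bigr => k _.
  by rewrite /ilog -iterSr.
rewrite ME in M0 *; rewrite pmulr_rgt0// in M0.
rewrite invfM mulrCA ler_pM2l ?invr_gt0//.
by rewrite ler_pdivlMr// mulrC ler_pdivrMr.
Qed.

Lemma expR_le1D2 z : 0 <= z <= 2^-1 -> expR z <= 1 + 2 * z.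
Proof.
move=> /andP[z0 z1]; rewrite -[z]opprK expRN invf_ple ?posrE ?expR_gt0//; last by lra.
apply: le_trans (expR_ge1Dx _); rewrite opprK -[leLHS]mul1r ler_pdivrMr; last by lra.
nra.
Qed.

(** [A] is minus the derivative of [ln g] in [ln r], and [ln r' - ln r = ln (1 + x) / 2], so the
    quotient is close to [(1 + x)^(- A / 2)]. The term with [K * delta] pays for linearising the
    logarithms: [s] of them with coefficient 1/2 and one with coefficient [eps <= 1], each at a cost
    of at most [4^s * delta * x^2]. *)
Lemma neighbour_bound (d s : nat) (eps delta r r' x : R) :
  (forall k, (k <= s)%N -> 1 <= ilog k r) -> (forall k, (k <= s)%N -> 0 < ilog k r') ->
  0 <= delta -> (forall i, (0 < i <= s)%N -> invprod i r ^+ 2 <= delta) ->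
  0 <= eps <= 1 -> r' ^+ 2 = r ^+ 2 * (1 + x) -> `|x| <= 8^-1 ->
  let A := d%:R / 2 + 2^-1 * (\sum_(1 <= i < s.+1) invprod i r) + eps * invprod s r in
  let K := (s%:R / 2 + 1) * 4 ^+ s in
  A * `|x| <= 2^-1 -> 2 ^+ s * `|x| <= 2^-1 -> K * delta * x ^+ 2 <= 2^-1 ->
  expR (log_weight (d%:R / 2) s eps r - log_weight (d%:R / 2) s eps r') <=
  1 - A / 2 * x + (A / 2 * (A / 2 + 1) / 2 + 4 * K * delta) * x ^+ 2 +
  (4 * (A / 2) + 2 * (A / 2) ^+ 2 + 8 * (A / 2) ^+ 3) * `|x| ^+ 3.
Proof.
move=> r1 r1' delta0 dP /andP[e0 e1] rx x8 A K Ax sx Kx.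
have rp : 0 < r by apply: lt_le_trans ltr01 _; exact: (r1 0%N).
have rp' : 0 < r' by exact: (r1' 0%N).
have := x8; rewrite ler_norml => /andP[xl xr].
have x1 : 0 < 1 + x by lra.
pose z i := ilog i.+1 r' - ilog i.+1 r.
have zE : z 0%N = 2^-1 * ln (1 + x).
  have : ln (r' ^+ 2) = ln (r ^+ 2) + ln (1 + x).
    by rewrite rx lnM ?posrE// exprn_gt0.
  by rewrite !lnXn// /z /ilog /= => h; lra.
have [|_ _ lna] := @ln1D_bounds R x; first by lra.
have zx : `|z 0%N| <= `|x|.
  by rewrite zE normrM ger0_norm//; lra.
have z2 : z 0%N ^+ 2 <= x ^+ 2.
  by rewrite -(real_normK (num_real (z 0%N))) -(real_normK (num_real x)) lerXn2r ?nnegrE.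
have s0 : 2 ^+ s * `|z 0%N| <= 2^-1 by apply: le_trans sx; rewrite ler_wpM2l ?exprn_ge0.
have incr i : (i <= s)%N -> [/\ z i <= invprod i r * z 0%N,
    invprod i r * z 0%N - 4 ^+ i * delta * z 0%N ^+ 2 <= z i &
    `|z i| <= 2 ^+ i * invprod i r * `|z 0%N|] := ilog_increment r1 r1' delta0 dP s0 (i := i).
have A0 : 0 <= A.
  apply: addr_ge0; first apply: addr_ge0; first by rewrite divr_ge0.
    rewrite mulr_ge0// big_nat; apply: sumr_ge0 => i /andP[i1 si].
    by have /andP[/ltW] := invprod_bounds r1 (si : (i <= s)%N).
  by rewrite mulr_ge0//; have /andP[/ltW] := invprod_bounds r1 (leqnn s).
have K0 : 0 <= K by rewrite mulr_ge0 ?addr_ge0 ?divr_ge0 ?exprn_ge0.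
pose theta := K * delta * z 0%N ^+ 2.
have Kd0 : 0 <= K * delta := mulr_ge0 K0 delta0.
have theta0 : 0 <= theta := mulr_ge0 Kd0 (sqr_ge0 _).
have thetax : theta <= K * delta * x ^+ 2 := ler_wpM2l Kd0 z2.
have D0 : 0 <= delta * z 0%N ^+ 2 by rewrite mulr_ge0 ?sqr_ge0.
have expo : log_weight (d%:R / 2) s eps r - log_weight (d%:R / 2) s eps r' <=
    - (A * z 0%N) + theta.
  have sumz : z 0%N * (\sum_(1 <= i < s.+1) invprod i r) - s%:R * (4 ^+ s * (delta * z 0%N ^+ 2))
      <= \sum_(1 <= i < s.+1) z i.
    have -> : s%:R * (4 ^+ s * (delta * z 0%N ^+ 2)) =
        \sum_(1 <= i < s.+1) (4 ^+ s * (delta * z 0%N ^+ 2)).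
      by rewrite sumr_const_nat subSS subn0 mulr_natl.
    rewrite mulr_sumr -sumrB !big_nat; apply: ler_sum => i /andP[i1 si].
    have [_ lo _] := incr i si; apply: le_trans lo.
    rewrite mulrC lerD2l lerN2 -mulrA ler_wpM2r// ler_eXn2l ?ltr1n//.
  have [_ zs _] := incr s (leqnn s).
  have ezs := ler_wpM2l e0 zs.
  have e4 : eps * (4 ^+ s * delta * z 0%N ^+ 2) <= 4 ^+ s * (delta * z 0%N ^+ 2).
    by rewrite -[in leLHS]mulrA ler_piMl// mulr_ge0 ?exprn_ge0.
  have LE : log_weight (d%:R / 2) s eps r' - log_weight (d%:R / 2) s eps r =
      d%:R / 2 * z 0%N + 2^-1 * (\sum_(1 <= i < s.+1) z i) + eps * z s.
    by rewrite /log_weight /z sumrB; ring.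
  have -> : theta = s%:R / 2 * (4 ^+ s * (delta * z 0%N ^+ 2)) +
      4 ^+ s * (delta * z 0%N ^+ 2) by rewrite /theta /K; ring.
  rewrite -opprB LE /A; set S1 := \sum_(_ <= _ < _) _ in sumz *.
  set S2 := \sum_(_ <= _ < _) _ in sumz *.
  set G := delta * _ ^+ 2 in D0 sumz e4 *.
  by rewrite mulrBr in ezs; lra.
(* The multiplicative error becomes additive through [e^theta <= 1 + 2 theta] and
   [e^(- A z0) <= 2]. *)
apply: (@le_trans _ _ (expR (- (A * z 0%N)) + 4 * theta)).
  apply: (@le_trans _ _ (expR (- (A * z 0%N)) * expR theta)).
    by rewrite -expRD ler_expR.
  have := @expR_le1D2 theta; rewrite theta0 (le_trans thetax Kx) => /(_ isT) et.
  have e2 : expR (- (A * z 0%N)) <= 2.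
    have Az : `|A * z 0%N| <= 2^-1.
      rewrite normrM ger0_norm//; apply: le_trans Ax; exact: ler_wpM2l.
    have Azn : A * z 0%N <= 2^-1 := le_trans (ler_norm _) Az.
    have := expR_ge1Dx (A * z 0%N); rewrite expRN invf_ple ?posrE ?expR_gt0//.
    by have := lerNnormlW Az; nra.
  apply: le_trans (ler_wpM2l (expR_ge0 _) et) _.
  rewrite mulrDr mulr1 lerD2l mulrA.
  rewrite [leLHS](_ : _ = (2 * expR (- (A * z 0%N))) * theta); last by ring.
  by rewrite ler_wpM2r//; lra.
have B0 : 0 <= A / 2 by rewrite divr_ge0.
have Bx : 2 * (A / 2) * `|x| <= 1.
  by rewrite (_ : 2 * (A / 2) = A); [lra|field].
have := expR_ln_taylor B0 x8 Bx.
rewrite (_ : A / 2 * ln (1 + x) = A * z 0%N); last by rewrite zE; ring.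
by lra.
Qed.

End Neighbours.

(** * The second condition implies the first *)

Section Supersolution.
Context {R : realType}.

Lemma weight_shift (d s : nat) (eps : R) (n m : 'rV[int]_d) :
  weight s eps m = expR (log_weight (d%:R / 2) s eps (enorm R n) -
    log_weight (d%:R / 2) s eps (enorm R m)) * weight s eps n.
Proof. by rewrite /weight -expRD addrAC subrr add0r. Qed.

Lemma invlog_sqr_bounds (s : nat) (r : R) : (forall k, (k <= s)%N -> 1 <= ilog k r) ->
  [/\ 0 <= invlog_sqr s r <= 1,
      forall i, (0 < i <= s)%N -> invprod i r ^+ 2 <= invlog_sqr s r,
      0 <= \sum_(1 <= i < s.+1) invprod i r <= s%:R &
      (\sum_(1 <= i < s.+1) invprod i r) ^+ 2 <= s%:R ^+ 2 * invlog_sqr s r].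
Proof.
move=> r1; case: s r1 => [|s] r1.
  by rewrite /= big_geq// expr0n mulr0 lexx ler01; split=> // -[].
set l := (ilog 1 r)^-1.
have l1 : 1 <= ilog 1 r by exact: r1.
have l0 : 0 < ilog 1 r := lt_le_trans ltr01 l1.
have li0 : 0 <= l by rewrite invr_ge0 ltW.
have li1 : l <= 1 by rewrite invf_le1.
have S0 : 0 <= \sum_(1 <= i < s.+2) invprod i r.
  rewrite big_nat; apply: sumr_ge0 => i /andP[i1 si].
  by have /andP[/ltW] := invprod_bounds r1 (si : (i <= s.+1)%N).
have Sl : \sum_(1 <= i < s.+2) invprod i r <= s.+1%:R * l.
  rewrite mulr_natl -[s.+1 in leRHS]/(s.+2 - 1)%N -sumr_const_nat !big_nat.
  by apply: ler_sum => i /andP[i1 si]; apply: (invprod_le1 r1); rewrite i1.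
split.
- by rewrite /= sqr_ge0 expr_le1.
- move=> i /andP[i0 si].
  have /andP[/ltW p0 _] := invprod_bounds r1 si.
  by rewrite /= lerXn2r ?nnegrE// (invprod_le1 r1)// i0.
- by rewrite S0 (le_trans Sl)// ler_piMr.
- by rewrite /= -exprMn lerXn2r ?nnegrE ?mulr_ge0.
Qed.

Lemma shift_coord_le (d : nat) (n : 'rV[int]_d) j : 1 <= enorm R n ->
  `|2 * (n ord0 j)%:~R + 1| <= 3 * enorm R n /\
  `|- (2 * (n ord0 j)%:~R) + 1| <= 3 * enorm R n.
Proof.
have := @enorm_coord R d n j; rewrite !ler_norml => /andP[cl cr] n1.
by split; apply/andP; split; lra.
Qed.

Lemma sum_enorm_sqr (d : nat) (n : 'rV[int]_d) :
  \sum_(j < d) ((n ord0 j)%:~R : R) ^+ 2 = enorm R n ^+ 2.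
Proof. by rewrite sqr_sqrtr// sumr_ge0// => j _; exact: sqr_ge0. Qed.

(** In the second-order expansion the terms linear in [n_j] cancel between the two directions, and
    the squares [n_j^2] sum to [|n|^2]; what is left at order [|n|^-2] is [- A d + 8 be]. *)
Lemma weight_supersolution (d s : nat) (eps : R) : 0 < eps ->
  exists2 eps', 0 < eps' & exists N : R, forall n : 'rV[int]_d, N <= enorm R n ->
    nbsum (weight s eps') n <=
    (2 * d%:R + (enorm R n ^+ 2)^-1 *
      (d%:R * (4 - d%:R) / 4 + \sum_(1 <= j < s.+1) invprod j (enorm R n) +
       eps * invprod s (enorm R n))) * weight s eps' n.
Proof.
(* The terms in [e] amount to at most [4 e P <= eps P / 2]: [2 e P] from the linear part, and
   [2 (e P)^2 <= 2 e P] from the square, where the cap by 1 is used. *)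
move=> eps0; pose e := Num.min 1 eps / 8.
have e0 : 0 < e by rewrite divr_gt0// lt_min ltr01.
have e1 : e <= 8^-1 by rewrite ler_pdivrMr// mulVf// ge_min lexx.
have e8 : 8 * e <= eps by rewrite mulrC divfK// ge_min lexx orbT.
exists e => //.
(* [Am], [bm], [gm] bound [A], [be], [ga] below uniformly in [n]; [C3] and [C4] collect the
   coefficients of the errors [1 / r] and [delta], and [eta] limits their total to [eps P / 8]. *)
pose Am : R := d%:R / 2 + s%:R / 2 + 1.
pose K : R := (s%:R / 2 + 1) * 4 ^+ s.
pose bm : R := Am / 2 * (Am / 2 + 1) / 2 + 4 * K.
pose gm : R := 4 * (Am / 2) + 2 * (Am / 2) ^+ 2 + 8 * (Am / 2) ^+ 3.
pose C3 : R := 2 * d%:R * bm + 54 * d%:R * gm.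
pose C4 : R := 32 * K + s%:R ^+ 2 / 2.
have Am0 : 0 <= Am by rewrite !addr_ge0 ?divr_ge0.
have Am2 : 0 <= Am / 2 by rewrite divr_ge0.
have K0 : 0 <= K by rewrite mulr_ge0 ?addr_ge0 ?divr_ge0 ?exprn_ge0.
have bm0 : 0 <= bm by rewrite addr_ge0 ?mulr_ge0 ?divr_ge0 ?mulr_ge0 ?addr_ge0.
have gm0 : 0 <= gm by rewrite !addr_ge0 ?mulr_ge0 ?exprn_ge0.
have C30 : 0 <= C3 by rewrite addr_ge0 ?mulr_ge0.
have C40 : 0 <= C4 by rewrite addr_ge0 ?mulr_ge0 ?divr_ge0 ?sqr_ge0.
pose eta : R := eps / (8 * (C3 + C4 + 1)).
have CC0 : 0 < C3 + C4 + 1 by lra.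
have eta0 : 0 < eta by rewrite divr_gt0// mulr_gt0.
have etaE : (C3 + C4 + 1) * eta = eps / 8 by rewrite /eta; field; rewrite gt_eqF.
have [X1 X1P] := @ilog_large R s 1.
have [X2 X2P] := invprod_large s eta0.
(* Since [|x| <= 3 / r] for neighbours, the four summands of the second threshold yield the four
   smallness conditions of [neighbour_bound]. *)
exists (Num.max (Num.max (X1 + 1) X2) (24 + 6 * Am + 6 * 2 ^+ s + 18 * K)) => n.
rewrite !ge_max -andbA => /and3P[rX1 rX2 rB].
set r := enorm R n in rX1 rX2 rB *.
have s2 : 0 <= 2 ^+ s :> R by rewrite exprn_ge0.
have rp : 0 < r by lra.
have r1 : forall k, (k <= s)%N -> 1 <= ilog k r by apply: X1P; lra.
have [/andP[dl0 dl1] dP /andP[S0 Ss] S2] := invlog_sqr_bounds r1.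
have [wP dlP] := X2P _ rX2.
have /andP[P0 P1] := invprod_bounds r1 (leqnn s).
set delta := invlog_sqr s r in dl0 dl1 dP S2 dlP *.
set S := \sum_(1 <= i < s.+1) invprod i r in S0 Ss S2 *.
set P := invprod s r in wP dlP P0 P1 *.
set w := r^-1 in wP *.
have w0 : 0 < w by rewrite invr_gt0.
have rw : r * w = 1 by rewrite divff ?gt_eqF.
pose A := d%:R / 2 + 2^-1 * S + e * P.
have d0 : 0 <= d%:R :> R by exact: ler0n.
have eP : e * P <= 1 by have := ler_wpM2l (ltW e0) P1; lra.
have eP0 : 0 <= e * P by rewrite mulr_ge0 ?ltW.
have A0 : 0 <= A by rewrite /A; clear - d0 S0 eP0; lra.
have AAm : A <= Am by rewrite /A /Am; clear - Ss eP; lra.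
have small (c : R) : 0 <= c -> 6 * c <= r -> c * (3 * w) <= 2^-1.
  move=> c0 cr; have := ler_wpM2r (ltW w0) cr; rewrite rw; clear; lra.
have r24 : 24 <= r by clear - rB Am0 s2 K0; lra.
have r_ge1 : 1 <= r by clear - r24; lra.
have w24 : 24 * w <= 1 by have := ler_wpM2r (ltW w0) r24; rewrite rw.
have w1 : w <= 1 by clear - w24 w0; lra.
have w2 : w ^+ 2 <= w by rewrite expr2 ler_piMr// ltW.
pose be := A / 2 * (A / 2 + 1) / 2 + 4 * K * delta.
pose ga := 4 * (A / 2) + 2 * (A / 2) ^+ 2 + 8 * (A / 2) ^+ 3.
have A2 : 0 <= A / 2 by rewrite divr_ge0.
have AA2 : A / 2 <= Am / 2 by rewrite ler_wpM2r.
have be0 : 0 <= be.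
  by rewrite addr_ge0 ?mulr_ge0// ?divr_ge0 ?mulr_ge0 ?addr_ge0.
have bebm : be <= bm.
  rewrite lerD//; last by rewrite -[leRHS]mulr1 ler_wpM2l// mulr_ge0.
  by rewrite ler_wpM2r// ler_pM ?addr_ge0 ?lerD2r.
have ga0 : 0 <= ga by rewrite !addr_ge0 ?mulr_ge0 ?exprn_ge0.
have gagm : ga <= gm.
  by rewrite !lerD// ler_wpM2l// lerXn2r ?nnegrE.
have nb (m : 'rV[int]_d) (t : R) : X1 <= enorm R m ->
    enorm R m ^+ 2 = r ^+ 2 + t -> `|t| <= 3 * r ->
    weight s e m <= (1 - A / 2 * (t * w ^+ 2) + be * (t * w ^+ 2) ^+ 2 +
       27 * ga * w ^+ 3) * weight s e n.
  move=> mX mE tr; rewrite (weight_shift s e n m) ler_wpM2r ?expR_ge0// -/r.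
  have x3 : `|t * w ^+ 2| <= 3 * w.
    rewrite normrM (ger0_norm (sqr_ge0 w)).
    have := ler_wpM2r (sqr_ge0 w) tr.
    have -> : 3 * r * w ^+ 2 = 3 * (r * w) * w by ring.
    by rewrite rw mulr1.
  have x2 : (t * w ^+ 2) ^+ 2 <= 9 * w ^+ 2.
    rewrite -(real_normK (num_real (t * w ^+ 2))) (_ : 9 * w ^+ 2 = (3 * w) ^+ 2).
      by rewrite lerXn2r ?nnegrE// mulr_ge0 ?ltW.
    by rewrite exprMn -natrX.
  apply: le_trans (@neighbour_bound R d s e delta r (enorm R m) (t * w ^+ 2)
     r1 _ dl0 dP _ _ _ _ _ _) _ => [k ks|||||||].
  - by apply: lt_le_trans ltr01 _; exact: X1P.
  - by rewrite ltW// (le_trans e1)// invf_le1// ler1n.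
  - by rewrite mE mulrDr mulr1 mulrCA -exprMn rw expr1n mulr1.
  - by apply: le_trans x3 _; clear - w24; lra.
  - apply: le_trans (ler_wpM2l A0 x3) _; apply: small => //.
    by clear - rB AAm s2 K0; lra.
  - apply: le_trans (ler_wpM2l s2 x3) _; apply: small => //.
    by clear - rB Am0 K0; lra.
  - have Kd : K * delta <= K by rewrite ler_piMr.
    apply: le_trans (_ : K * (9 * w) <= _).
      apply: ler_pM => //; [exact: mulr_ge0|exact: sqr_ge0|].
      by clear - x2 w2; lra.
    have := small (3 * K); rewrite mulr_ge0// => /(_ isT).
    by clear - rB Am0 s2; lra.
  rewrite -/S -/P -/A -/K -/be -/ga lerD2l.
  rewrite [leRHS](_ : _ = ga * (27 * w ^+ 3)); last by ring.
  rewrite ler_wpM2l//.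
  apply: (@le_trans _ _ ((3 * w) ^+ 3)).
    by rewrite lerXn2r ?nnegrE// mulr_ge0 ?ltW.
  by rewrite exprMn -natrX.
have pair (j : 'I_d) : weight s e (n + basisv j) + weight s e (n - basisv j) <=
    (2 - A * w ^+ 2 + be * (8 * (n ord0 j)%:~R ^+ 2 + 2) * w ^+ 4 +
     54 * ga * w ^+ 3) * weight s e n.
  have [Ep Em] := @enorm_basisv_le R d n j.
  have [sp sm] := @enorm_shift_ge R d n j.
  have [tp tm] := shift_coord_le j r_ge1.
  set c : R := (n ord0 j)%:~R in Ep Em tp tm *.
  have Xr : X1 <= r - 1 by rewrite lerBrDr.
  have hp := nb _ _ (le_trans Xr sp) Ep tp.
  rewrite -addrA in Em; have hm := nb _ _ (le_trans Xr sm) Em tm.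
  apply: le_trans (lerD hp hm) _; rewrite -mulrDl ler_wpM2r ?expR_ge0//.
  by rewrite le_eqVlt; apply/orP; left; apply/eqP; field.
apply: le_trans (ler_sum _ (fun j _ => pair j)) _.
rewrite -mulr_suml ler_wpM2r ?expR_ge0//.
have -> : \sum_(j < d) (2 - A * w ^+ 2 + be * (8 * (n ord0 j)%:~R ^+ 2 + 2) * w ^+ 4 +
     54 * ga * w ^+ 3) = d%:R * (2 - A * w ^+ 2 + 2 * be * w ^+ 4 + 54 * ga * w ^+ 3) +
     8 * be * w ^+ 4 * r ^+ 2.
  have sumc (c : R) : d%:R * c = \sum_(j < d) c by rewrite sumr_const card_ord mulr_natl.
  rewrite -sum_enorm_sqr mulr_sumr sumc -big_split /=.
  by apply: eq_bigr => j _; ring.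
have -> : 8 * be * w ^+ 4 * r ^+ 2 = 8 * be * w ^+ 2 * (r * w) ^+ 2 by ring.
rewrite rw expr1n mulr1 -exprVn -/w.
have key : - A * d%:R + 8 * be + 2 * d%:R * be * w ^+ 2 + 54 * d%:R * ga * w <=
    d%:R * (4 - d%:R) / 4 + S + eps * P.
  have h1 : 2 * d%:R * be * w ^+ 2 + 54 * d%:R * ga * w <= C3 * w.
    have d2 : 0 <= 2 * d%:R :> R by rewrite mulr_ge0.
    have d54 : 0 <= 54 * d%:R :> R by rewrite mulr_ge0.
    have := ler_wpM2l d2 (ler_pM be0 (sqr_ge0 w) bebm w2).
    have := ler_wpM2l d54 (ler_wpM2r (ltW w0) gagm).
    by rewrite [C3 * w]mulrDl !mulrA; clear; lra.
  have h2 : C3 * w <= C3 * eta * P by rewrite -mulrA ler_wpM2l.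
  have h3 : C4 * delta <= C4 * eta * P by rewrite -mulrA ler_wpM2l.
  have h4 : (C3 + C4) * eta * P <= eps / 8 * P.
    by rewrite -etaE ler_wpM2r ?(ltW P0)// ler_wpM2r ?(ltW eta0)// lerDl.
  (* [(a + b)^2 <= 2 a^2 + 2 b^2], with [S^2] absorbed into [delta]. *)
  have h5 : (2^-1 * S + e * P) ^+ 2 <= s%:R ^+ 2 * delta / 2 + 2 * (e * P) ^+ 2.
    have := sqr_ge0 (2^-1 * S - e * P); clear - S2; lra.
  have h6 : (e * P) ^+ 2 <= e * P by rewrite expr2 ler_piMr.
  have h7 : 8 * (e * P) <= eps * P by rewrite mulrA ler_wpM2r ?(ltW P0).
  have h8 : - A * d%:R + 8 * be = d%:R * (4 - d%:R) / 4 + 2 * (2^-1 * S + e * P) +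
      (2^-1 * S + e * P) ^+ 2 + 32 * K * delta by rewrite /be /A; field.
  have h9 : C4 * delta = 32 * K * delta + s%:R ^+ 2 * delta / 2 by rewrite /C4; ring.
  clear - h1 h2 h3 h4 h5 h6 h7 h8 h9 P0 eps0; nra.
have := ler_wpM2l (sqr_ge0 w) key.
rewrite (_ : d%:R * (2 - A * w ^+ 2 + 2 * be * w ^+ 4 + 54 * ga * w ^+ 3) +
  8 * be * w ^+ 2 = 2 * d%:R + w ^+ 2 * (- A * d%:R + 8 * be +
  2 * d%:R * be * w ^+ 2 + 54 * d%:R * ga * w)); last by ring.
by rewrite lerD2l.
Qed.

End Supersolution.

Unset Implicit Arguments.

Theorem theorem22 (R : realType) (d : nat) (hd : (0 < d)%N) (V : 'rV[int]_d -> R)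
    (hsup : sup_real (spectrum (schrodinger V)) = (4 * d%:R)%:E)
    (hess : sup_real (essential_spectrum (schrodinger V)) = (4 * d%:R)%:E)
    (hcrit : critical_from_above V (4 * d%:R)) :
  ((exists (s : nat) (eps : R), 0 < eps /\
      exists N : R, forall n : 'rV[int]_d, N <= enorm R n ->
        V n <= 2 * d%:R
          - \sum_(j < d)
              (enorm R n / enorm R (n + basisv j)) `^ (d%:R / 2)
              * (\prod_(1 <= i < s.+1)
                   Num.sqrt (ilog i (enorm R n) / ilog i (enorm R (n + basisv j))))
              * (ilog s (enorm R n) / ilog s (enorm R (n + basisv j))) `^ eps
          - \sum_(j < d)
              (enorm R n / enorm R (n - basisv j)) `^ (d%:R / 2)
              * (\prod_(1 <= i < s.+1)
                   Num.sqrt (ilog i (enorm R n) / ilog i (enorm R (n - basisv j))))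
              * (ilog s (enorm R n) / ilog s (enorm R (n - basisv j))) `^ eps) ->
    point_spectrum (schrodinger V) (4 * d%:R)%:C)
  /\
  ((exists (s : nat) (eps : R), 0 < eps /\
      exists N : R, forall n : 'rV[int]_d, N <= enorm R n ->
        V n <= - (d%:R * (4 - d%:R) / (4 * enorm R n ^+ 2))
          - (enorm R n ^+ 2)^-1
              * (\sum_(1 <= j < s.+1) \prod_(1 <= k < j.+1) (ilog k (enorm R n))^-1)
          - eps / enorm R n ^+ 2
              * (\prod_(1 <= k < s.+1) (ilog k (enorm R n))^-1)) ->
    point_spectrum (schrodinger V) (4 * d%:R)%:C).
Proof.
have large s : exists X : R, forall x, X <= x -> forall k, (k <= s)%N -> 0 < ilog k x.
  have [X XP] := @ilog_large R s 1; exists X => x Xx k ks.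
  by apply: lt_le_trans ltr01 _; exact: XP.
split=> -[s [eps [eps0 [N VN]]]].
  apply: (eigenvalue_of_weight (s := s) hd eps0 hcrit).
  have [X XP] := large s; exists (Num.max N (X + 1)) => n.
  rewrite ge_max => /andP[Nn Xn].
  have rn : forall k, (k <= s)%N -> 0 < ilog k (enorm R n) by apply: XP; lra.
  have ratio (m : 'rV[int]_d) : X <= enorm R m -> weight s eps m =
      (enorm R n / enorm R m) `^ (d%:R / 2) *
      (\prod_(1 <= i < s.+1) Num.sqrt (ilog i (enorm R n) / ilog i (enorm R m))) *
      (ilog s (enorm R n) / ilog s (enorm R m)) `^ eps * weight s eps n.
    move=> Xm; rewrite (weight_shift s eps n m); congr (_ * _).
    by apply: esym; exact: (ratio_weight d eps rn (XP _ Xm)).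
  have Xp (j : 'I_d) : X <= enorm R (n + basisv j).
    by apply: le_trans (@enorm_shift_ge R d n j).1; rewrite lerBrDr.
  have Xm (j : 'I_d) : X <= enorm R (n - basisv j).
    by apply: le_trans (@enorm_shift_ge R d n j).2; rewrite lerBrDr.
  rewrite /nbsum; under eq_bigr => j _ do rewrite (ratio _ (Xp j)) (ratio _ (Xm j)).
  have sumM (a b : 'I_d -> R) (c : R) : \sum_j (a j * c + b j * c) =
      (\sum_j a j + \sum_j b j) * c by rewrite mulrDl !mulr_suml big_split.
  rewrite sumM.
  apply: ler_wpM2r; first exact: expR_ge0.
  have := VN n Nn; rewrite -addrA -opprD => VNn.
  by rewrite -lerN2 opprB lerBlDl.
(* The supersolution is built with the smaller exponent [e]; the bound on V then enters only through
   algebra. *)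
have [e e0 [M MP]] := @weight_supersolution R d s eps eps0.
apply: (eigenvalue_of_weight (s := s) hd e0 hcrit).
exists (Num.max (Num.max N M) 1) => n; rewrite !ge_max -andbA => /and3P[Nn Mn n1].
apply: le_trans (MP n Mn) _; rewrite ler_wpM2r ?expR_ge0// lerD2l.
have r0 : 0 < enorm R n by lra.
rewrite lerNr; apply: le_trans (VN n Nn) _.
rewrite le_eqVlt; apply/orP; left; apply/eqP; rewrite /invprod.
by field; rewrite gt_eqF.
Qed.
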